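(* Let $\Pi$ be a graph class on which \textsc{Hamiltonian Cycle} is NP-hard. Then \textsc{Unweighted Connectivity NWS} is NP-complete on input graphs from $\Pi$, even if $t=1$.
   Context: An instance of \textsc{Connectivity NWS} consists of a graph $G$, a collection $\mathcal{C}$ of subsets of $V(G)$ (communities), an edge-weight function $\omega: E(G)\to \mathbb{R}_+$, an integer $\ell$, and a positive real $b$; the question is whether there is a spanning subgraph $G'=(V(G),E')$ with $E'\subseteq E(G)$, $|E'|\le\ell$, $\omega(E')\le b$, such that $G'[C]$ is connected for every $C\in\mathcal{C}$. \textsc{Unweighted Connectivity NWS} is the special case with all edge weights equal to $1$. The parameter $t$ is $\ell-n+x$, where $n=|V(G)|$ and $x$ is the number of connected components of the hypergraph $(V(G),\mathcal{C})$ (the feedback edge number of a solution). \textsc{Hamiltonian Cycle} asks whether a graph contains a cycle through every vertex exactly once. *)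

(* Defs.v *)
From HB Require Import structures.
From Corelib Require Import BinNums.
From mathcomp Require Import all_boot all_order all_algebra.

Set Implicit Arguments.
Unset Strict Implicit.
Unset Printing Implicit Defensive.

Import Order.TTheory GRing.Theory Num.Theory.

Definition bits := seq bool.

(* [None] is the blank. *)
Definition symbol := option bool.

(* [None] is "stay", [Some false] is "left" and [Some true] is "right". *)
Definition direction := option bool.

(* [(l, r)] is a two-way infinite tape: [r] starts at the scanned cell, [l]
   lists the cells to its left, nearest first; all cells beyond are blank. *)
Definition tape : Type := seq symbol * seq symbol.

Definition tape_read (tp : tape) : symbol := head None tp.2.

Definition tape_write (s : symbol) (tp : tape) : tape :=
  (tp.1, s :: behead tp.2).

Definition tape_move (d : direction) (tp : tape) : tape :=
  match d with
  | None => tp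
  | Some false => (behead tp.1, head None tp.1 :: tp.2)
  | Some true => (head None tp.2 :: tp.1, behead tp.2)
  end.

Definition tape_input (x : bits) : tape := ([::], map Some x).

(* The word that starts at the scanned cell and ends before the first blank. *)
Definition tape_output (tp : tape) : bits :=
  pmap id (take (index None tp.2) tp.2).

(* A deterministic multi-tape machine with [extra_tapes.+1] tapes; the
   first one holds the input and the last one the output (they coincide when there is a single tape). *)
Record turing_machine := TuringMachine {
  extra_tapes : nat;
  state : finType;
  start : state;
  halting : pred state;
  transition : state -> {ffun 'I_extra_tapes.+1 -> symbol} ->
    state * {ffun 'I_extra_tapes.+1 -> symbol * direction}
}.

Definition config (M : turing_machine) : Type :=
  state M * {ffun 'I_(extra_tapes M).+1 -> tape}.

Definition tm_init (M : turing_machine) (x : bits) : config M :=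
  (start M, [ffun i => tape_input (if i == ord0 then x else [::])]).

Definition tm_step (M : turing_machine) (c : config M) : config M :=
  if halting c.1 then c else
  let a := transition c.1 [ffun i => tape_read (c.2 i)] in
  (a.1, [ffun i => tape_move (a.2 i).2 (tape_write (a.2 i).1 (c.2 i))]).

Definition computes_within (M : turing_machine) (x y : bits) (t : nat) : Prop :=
  let c := iter t (@tm_step M) (tm_init M x) in
  halting c.1 /\ tape_output (c.2 ord_max) = y.

Definition polytime (f : bits -> bits) : Prop :=
  exists (M : turing_machine) (p : {poly nat}),
    forall x, computes_within M x (f x) p.[size x]%R.

(* A self-delimiting code: each bit is preceded by [true], and each word is
   terminated by [false]. *)
Definition enc_word (w : bits) : bits :=
  flatten [seq [:: true; b] | b <- w] ++ [:: false].

Definition enc_seq (ws : seq bits) : bits := flatten (map enc_word ws).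

(* Binary notation, least significant bit first; 0 is the empty word. *)
Fixpoint enc_pos (p : positive) : bits :=
  match p with
  | xH => [:: true]
  | xO q => false :: enc_pos q
  | xI q => true :: enc_pos q
  end.

Definition enc_nat (n : nat) : bits :=
  if bin_of_nat n is Npos p then enc_pos p else [::].

Definition enc_int (z : int) : bits := (z < 0)%R :: enc_nat `|z|%N.

Definition enc_rat (q : rat) : bits :=
  enc_seq [:: enc_int (numq q); enc_int (denq q)].

(* A decision problem with instances restricted to [valid] ones. [valid] acts
   as a promise, as usual for problems restricted to a class of inputs: it is
   not required to be recognizable in polynomial time. *)
Record problem := Problem {
  instance : Type;
  encode : instance -> bits;
  valid : instance -> Prop;
  yes : instance -> Prop
}.

Definition restrict (P : problem) (D : instance P -> Prop) : problem :=
  Problem (@encode P) (fun I => valid I /\ D I) (@yes P).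

Definition language (L : bits -> Prop) : problem :=
  Problem id (fun _ => True) L.

Definition in_NP (P : problem) : Prop :=
  exists (V : bits -> bits) (p : {poly nat}),
    polytime V /\
    forall I : instance P, valid I ->
      (yes I <-> exists u : bits,
         (size u <= p.[size (encode I)]%R)%N /\
         V (enc_seq [:: encode I; u]) = [:: true]).

Definition NP_hard (P : problem) : Prop :=
  forall L : bits -> Prop, in_NP (language L) ->
    exists f : bits -> instance P,
      polytime (fun x => encode (f x)) /\
      forall x, valid (f x) /\ (L x <-> yes (f x)).

Definition NP_complete (P : problem) : Prop := in_NP P /\ NP_hard P.

Record graph := Graph {
  order : nat;
  edges : {set {set 'I_order}};
  card_edge : forall e, e \in edges -> #|e| = 2
}.

Notation vertex G := 'I_(order G).

Definition adj (T : finType) (E : {set {set T}}) : rel T :=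
  fun x y => [set x; y] \in E.

Definition induced_adj (T : finType) (E : {set {set T}}) (C : {set T}) : rel T :=
  fun x y => [&& x \in C, y \in C & adj E x y].

(* Connectedness of the subgraph of [(T, E)] induced by [C]; the graph without
   vertices is not connected. *)
Definition induced_connected (T : finType) (E : {set {set T}}) (C : {set T}) :
    Prop :=
  C != set0 /\ {in C &, forall x y, connect (induced_adj E C) x y}.

Definition enc_set (n : nat) (A : {set 'I_n}) : bits :=
  [seq i \in A | i <- enum 'I_n].

(* The adjacency matrix, row by row. *)
Definition enc_graph (G : graph) : bits :=
  enc_seq [seq [seq adj (edges G) i j | j <- enum (vertex G)]
          | i <- enum (vertex G)].

Definition graph_class := graph -> Prop.

Definition is_hamiltonian_cycle (G : graph) (s : seq (vertex G)) : Prop :=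
  [/\ 2 < size s, ucycle (adj (edges G)) s & forall x, x \in s].

Definition hamiltonian_cycle : problem :=
  Problem enc_graph (fun _ => True)
    (fun G => exists s : seq (vertex G), is_hamiltonian_cycle s).

(* Only the values of the weight function [w] on the edges of [G] matter. *)
Definition connectivity_nws_solution (R : numDomainType) (G : graph)
    (Cs : seq {set vertex G}) (w : {set vertex G} -> R) (l : int) (b : R)
    (E' : {set {set vertex G}}) : Prop :=
  [/\ E' \subset edges G,
      (#|E'|%:Z <= l)%R,
      (\sum_(e in E') w e <= b)%R &
      forall C, C \in Cs -> induced_connected E' C].

(* Instances with unit weights. The budget is rational so that instances have
   finite encodings. *)
Record unweighted_nws_instance := UnweightedNWS {
  nws_graph : graph;
  communities : seq {set vertex nws_graph};
  edge_bound : int;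
  budget : rat
}.

Definition enc_unweighted_nws (I : unweighted_nws_instance) : bits :=
  enc_seq [:: enc_graph (nws_graph I);
              enc_seq [seq enc_set C | C <- communities I];
              enc_int (edge_bound I);
              enc_rat (budget I)].

Definition unweighted_connectivity_nws : problem :=
  Problem enc_unweighted_nws (fun I => (0 < budget I)%R)
    (fun I => exists E', connectivity_nws_solution
       (communities I) (fun _ => 1%R) (edge_bound I) (budget I) E').

(* Two vertices are adjacent if they share a hyperedge; vertices that lie in no
   hyperedge are components of their own. *)
Definition hypergraph_components (T : finType) (Cs : seq {set T}) : nat :=
  n_comp (fun x y => has (fun C : {set T} => (x \in C) && (y \in C)) Cs) T.

Definition nws_t (I : unweighted_nws_instance) : int :=
  (edge_bound I - (order (nws_graph I))%:Z
   + (hypergraph_components (communities I))%:Z)%R.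

(* Main.v *)
Require Import Defs.
From HB Require Import structures.
From Corelib Require Import BinNums PosDef.
From mathcomp Require Import all_boot all_order all_algebra.
From mathcomp Require Import zify.

(** Hardness: for a graph on n >= 3 vertices take as communities the complements
    of the single vertices, and allow n edges; the communities form a connected
    hypergraph, so t = 1. A Hamiltonian cycle is a solution. Conversely, a
    solution stays connected after the deletion of any vertex, so every degree
    is at least 2; as there are at most n edges, every degree is exactly 2, and
    a connected 2-regular graph is a cycle. Graphs on fewer vertices are mapped
    to an instance whose only community is empty, which has no solution.

    Membership: the certificate is a 0/1 matrix selecting edges. Connectivity of
    each community is checked by n rounds of breadth-first search from some
    root.

    Polynomial time: values are binary trees, written as self-delimiting prefix
    codes on a stack; a program for a function replaces the code on top of the
    stack, so that composition is sequencing. Programs use four stacks and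
    compile to four-tape machines. The functions so computed are closed under
    pairing, case distinction and folds with polynomially bounded accumulators,
    so the verifier and the reduction are ordinary functions on lists. *)

Set Implicit Arguments.
Unset Strict Implicit.
Unset Printing Implicit Defensive.

Import Order.TTheory GRing.Theory Num.Theory.

(** * Stack programs and the machines they compile to *)

Inductive reg := Input | Work | Scratch | Output.

Record store :=
  Store { input : bits; work : bits; scratch : bits; output : bits }.

Definition get (m : store) (r : reg) : bits :=
  match r with
  | Input => input m
  | Work => work m
  | Scratch => scratch m
  | Output => output m
  end.

Definition put (r : reg) (w : bits) (m : store) : store :=
  match r with
  | Input => Store w (work m) (scratch m) (output m)
  | Work => Store (input m) w (scratch m) (output m)
  | Scratch => Store (input m) (work m) w (output m)
  | Output => Store (input m) (work m) (scratch m) w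
  end.

Definition top (w : bits) : symbol := head None (map Some w).

Inductive prog :=
| Skip
| Push (r : reg) (b : bool)
| Pop (r : reg)
| Seq (p q : prog)
| If (r : reg) (test : pred symbol) (p q : prog)
| While (r : reg) (test : pred symbol) (p : prog).

Local Notation "p ;; q" := (Seq p q) (at level 55, right associativity).

(* The number bounds the running time of the compiled machine, which needs two
   steps for a push and one for each pop, test and jump. *)
Inductive run : prog -> store -> store -> nat -> Prop :=
| run_skip m : run Skip m m 0
| run_push r b m : run (Push r b) m (put r (b :: get m r) m) 2
| run_pop r m : run (Pop r) m (put r (behead (get m r)) m) 1
| run_seq m2 p q m1 m3 n1 n2 :
    run p m1 m2 n1 -> run q m2 m3 n2 -> run (p ;; q) m1 m3 (n1 + n2)
| run_if r (test : pred symbol) p q m m' n :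
    run (if test (top (get m r)) then p else q) m m' n ->
    run (If r test p q) m m' n.+2
| run_while m2 r (test : pred symbol) p m1 m3 n1 n2 :
    test (top (get m1 r)) -> run p m1 m2 n1 ->
    run (While r test p) m2 m3 n2 ->
    run (While r test p) m1 m3 (n1 + n2).+2
| run_while_end r (test : pred symbol) p m :
    ~~ test (top (get m r)) -> run (While r test p) m m 1
| run_leq n p m m' n' : n <= n' -> run p m m' n -> run p m m' n'.

Definition store_size (m : store) : nat :=
  size (input m) + size (work m) + size (scratch m) + size (output m).

Lemma run_store_size p m m' n :
  run p m m' n -> store_size m' <= store_size m + n.
Proof.
elim=> {p m m' n}; rewrite /store_size; try by move=> *; lia.
- by case=> b m /=; lia.
- by case=> m /=; rewrite size_behead; lia.
Qed.

(* An instruction works on one tape; the last component is the address of the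
   next instruction. *)
Definition instr : Type := reg * (symbol -> symbol * direction * nat).

Definition jump (r : reg) (target : symbol -> nat) : instr :=
  (r, fun s => (s, None, target s)).

Fixpoint compile (p : prog) (a : nat) : seq instr :=
  match p with
  | Skip => [::]
  | Push r b => [:: (r, fun s => (s, Some false, a.+1));
                    (r, fun _ => (Some b, None, a.+2))]
  | Pop r => [:: (r, fun _ => (None, Some true, a.+1))]
  | Seq p q => compile p a ++ compile q (a + size (compile p a))
  | If r test p q =>
      let else_addr := (a.+1 + size (compile p a.+1)).+1 in
      jump r (fun s => if test s then a.+1 else else_addr) ::
      compile p a.+1 ++
      jump r (fun _ => else_addr + size (compile q else_addr)) ::
      compile q else_addr
  | While r test p =>
      let exit_addr := (a.+1 + size (compile p a.+1)).+1 in
      jump r (fun s => if test s then a.+1 else exit_addr) ::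
      compile p a.+1 ++ [:: jump r (fun _ => a)]
  end.

Definition reg_tape (r : reg) : 'I_4 :=
  match r with
  | Input => @Ordinal 4 0 isT
  | Work => @Ordinal 4 1 isT
  | Scratch => @Ordinal 4 2 isT
  | Output => @Ordinal 4 3 isT
  end.

Lemma reg_tape_inj : injective reg_tape.
Proof. by case=> [] []. Qed.

Lemma get_put r r' w m :
  get (put r w m) r' = if reg_tape r' == reg_tape r then w else get m r'.
Proof. by case: r r' => [] []. Qed.

Lemma put_get r m : put r (get m r) m = m.
Proof. by case: r m => [] []. Qed.

Definition halt_instr : instr := jump Input (fun _ => 0).

Definition instr_machine (instrs : seq instr) : turing_machine :=
  @TuringMachine 3 'I_(size instrs).+1 ord0 (pred1 ord_max)
    (fun a scanned =>
       let i := nth halt_instr instrs a in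
       let action := i.2 (scanned (reg_tape i.1)) in
       (inord action.2,
        [ffun j => if j == reg_tape i.1 then action.1 else (scanned j, None)])).

(* Not the identity: a scanned cell beyond the recorded tape is appended. *)
Definition touch (tp : tape) : tape := tape_write (tape_read tp) tp.

Lemma instr_machine_step instrs a r f s d a' (tps : {ffun 'I_4 -> tape}) :
  a < size instrs -> nth halt_instr instrs a = (r, f) ->
  f (tape_read (tps (reg_tape r))) = (s, d, a') ->
  @tm_step (instr_machine instrs) (inord a, tps) =
    (inord a', [ffun j => if j == reg_tape r
                          then tape_move d (tape_write s (tps j))
                          else touch (tps j)]).
Proof.
move=> lt_a instr_a f_read.
have val_a : nat_of_ord (inord a : 'I_(size instrs).+1) = a.
  by rewrite inordK // ltnW.
rewrite /tm_step /=; case: eqP => [/(congr1 val) /=|_].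
  by rewrite val_a => a_size; rewrite a_size ltnn in lt_a.
rewrite val_a instr_a /= ffunE f_read /=; congr pair.
by apply/ffunP => j; rewrite !ffunE; case: ifP => // _; rewrite /touch ffunE.
Qed.

Definition holds (w : bits) (tp : tape) : Prop :=
  exists k, tp.2 = map Some w ++ nseq k None.

Lemma holds_read w tp : holds w tp -> tape_read tp = top w.
Proof. by case=> k; rewrite /tape_read => ->; case: w => //=; case: k. Qed.

Lemma holds_touch w tp : holds w tp -> holds w (touch tp).
Proof.
case=> k; rewrite /touch /tape_read /tape_write /holds /= => ->.
case: w => [|b w] /=; last by exists k.
by case: k => [|k] /=; [exists 1 | exists k.+1].
Qed.

Lemma holds_push w tp b :
  holds w tp ->
  holds (b :: w) (tape_write (Some b) (tape_move (Some false) (touch tp))).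
Proof.
move/holds_touch; case: (touch tp) => l r [k /= r_eq].
by exists k; rewrite /= r_eq.
Qed.

Lemma holds_pop w tp :
  holds w tp -> holds (behead w) (tape_move (Some true) (tape_write None tp)).
Proof.
case=> k; rewrite /holds /= => ->; case: w => [|b w] /=; last by exists k.
by case: k => [|k]; [exists 0 | exists k].
Qed.

Lemma holds_output w tp : holds w tp -> tape_output tp = w.
Proof.
case=> k eq_tp; rewrite /tape_output eq_tp.
have -> : index None (map Some w ++ nseq k None) = size w.
  elim: w {eq_tp} => [|b w IHw] //=; first by case: k.
  by rewrite IHw.
rewrite take_cat size_map ltnn subnn take0 cats0.
exact: (map_pK (g := Some)).
Qed.

Definition represents (m : store) (tps : {ffun 'I_4 -> tape}) : Prop :=
  forall r, holds (get m r) (tps (reg_tape r)).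

Lemma represents_put m r w tps (act : tape -> tape) :
  represents m tps -> holds w (act (tps (reg_tape r))) ->
  represents (put r w m)
    [ffun j => if j == reg_tape r then act (tps j) else touch (tps j)].
Proof.
move=> rep_m holds_w r'; rewrite ffunE get_put.
by case: eqP => [/reg_tape_inj -> //|_]; apply: holds_touch.
Qed.

Definition instrs_at (instrs : seq instr) (a : nat) (c : seq instr) : Prop :=
  exists2 pre, size pre = a & exists post, instrs = pre ++ c ++ post.

Lemma instrs_at_cat instrs a c c' : instrs_at instrs a (c ++ c') ->
  instrs_at instrs a c /\ instrs_at instrs (a + size c) c'.
Proof.
case=> pre <- [post ->]; split.
  by exists pre => //; exists (c' ++ post); rewrite -!catA.
by exists (pre ++ c); [rewrite size_cat | exists post; rewrite -!catA].
Qed.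

Lemma instrs_at_cons instrs a i c : instrs_at instrs a (i :: c) ->
  [/\ a < size instrs, nth halt_instr instrs a = i & instrs_at instrs a.+1 c].
Proof.
case=> pre <- [post ->]; split.
- by rewrite size_cat /=; lia.
- by rewrite nth_cat ltnn subnn.
- exists (rcons pre i); first by rewrite size_rcons.
  by exists post; rewrite cat_rcons.
Qed.

Section Simulation.

Variable instrs : seq instr.

Let step := @tm_step (instr_machine instrs).

Definition reaches (n a : nat) (m : store) (a' : nat) (m' : store) : Prop :=
  forall tps, represents m tps ->
  exists n' tps', [/\ n' <= n, represents m' tps' &
                      iter n' step (inord a, tps) = (inord a', tps')].

Lemma reaches_refl a m : reaches 0 a m a m.
Proof. by move=> tps rep_m; exists 0, tps. Qed.

Lemma reaches_leq n n' a m a' m' :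
  n <= n' -> reaches n a m a' m' -> reaches n' a m a' m'.
Proof.
move=> le_n reach tps /reach [k [tps' [le_k rep_m' iter_k]]].
by exists k, tps'; split=> //; apply: leq_trans le_n.
Qed.

Lemma reaches_trans a2 m2 n1 n2 a1 m1 a3 m3 :
  reaches n1 a1 m1 a2 m2 -> reaches n2 a2 m2 a3 m3 ->
  reaches (n1 + n2) a1 m1 a3 m3.
Proof.
move=> reach1 reach2 tps /reach1 [k1 [tps1 [le_k1 /reach2 rep1 iter1]]].
have [k2 [tps2 [le_k2 rep2 iter2]]] := rep1.
exists (k2 + k1), tps2; split=> //; first by rewrite addnC leq_add.
by rewrite iterD iter1.
Qed.

Lemma reaches_instr a r f s d a' w m c :
  instrs_at instrs a ((r, f) :: c) -> f (top (get m r)) = (s, d, a') ->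
  (forall tp, holds (get m r) tp -> holds w (tape_move d (tape_write s tp))) ->
  reaches 1 a m a' (put r w m).
Proof.
move=> /instrs_at_cons[lt_a instr_a _] f_top act_holds tps rep_m.
have f_read : f (tape_read (tps (reg_tape r))) = (s, d, a').
  by rewrite (holds_read (rep_m r)).
exists 1; eexists; split=> //; last first.
  exact: instr_machine_step lt_a instr_a f_read.
apply: (represents_put (act := fun tp => tape_move d (tape_write s tp))) => //.
exact: act_holds.
Qed.

Lemma reaches_jump a r target m c :
  instrs_at instrs a (jump r target :: c) ->
  reaches 1 a m (target (top (get m r))) m.
Proof.
move=> at_a; rewrite -{3}(put_get r m); apply: reaches_instr at_a erefl _.
by move=> tp holds_r; rewrite -(holds_read holds_r); apply: holds_touch.
Qed.

Lemma reaches_pop a r m :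
  instrs_at instrs a (compile (Pop r) a) ->
  reaches 1 a m a.+1 (put r (behead (get m r)) m).
Proof.
move=> at_a; apply: reaches_instr at_a erefl _ => tp.
exact: holds_pop.
Qed.

Lemma reaches_push a r b m :
  instrs_at instrs a (compile (Push r b) a) ->
  reaches 2 a m a.+2 (put r (b :: get m r) m).
Proof.
case/instrs_at_cons=> lt_a instr_a /instrs_at_cons[lt_a1 instr_a1 _] tps rep_m.
exists 2; eexists; split=> //; last first.
  rewrite /step /= (instr_machine_step lt_a instr_a erefl).
  by rewrite (instr_machine_step lt_a1 instr_a1 erefl); reflexivity.
move=> r'; rewrite !ffunE get_put; case: eqP => [/reg_tape_inj ->|_].
  exact: holds_push.
by do 2!apply: holds_touch.
Qed.

Lemma compile_reaches p m m' n : run p m m' n ->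
  forall a, instrs_at instrs a (compile p a) ->
  reaches n a m (a + size (compile p a)) m'.
Proof.
elim=> {p m m' n} [m|r b m|r m|m2 p q m1 m3 n1 n2 _ IHp _ IHq
  |r test p q m m' n _ IH|m2 r test p m1 m3 n1 n2 test_r _ IHp _ IHwhile
  |r test p m test_r|n p m m' n' le_n _ IHp] a at_a.
- by rewrite addn0; apply: reaches_refl.
- by rewrite addn2; apply: reaches_push.
- by rewrite addn1; apply: reaches_pop.
- have [/= at_p at_q] := instrs_at_cat at_a.
  by rewrite /= size_cat addnA; apply: reaches_trans (IHp _ at_p) (IHq _ at_q).
- rewrite /= in at_a *.
  have [_ _ /instrs_at_cat[at_p at_jump]] := instrs_at_cons at_a.
  have [_ _ at_q] := instrs_at_cons at_jump.
  have := reaches_jump (m := m) at_a; move: IH; case: (test _) => IH to_branch.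
    apply: (@reaches_leq (1 + n + 1)); first by rewrite addn1.
    apply: reaches_trans (reaches_trans to_branch (IH _ at_p)) _.
    have := reaches_jump (m := m') at_jump.
    by rewrite size_cat /= !addnS !addSn addnA.
  apply: (@reaches_leq (1 + n)) => //; apply: reaches_trans to_branch _.
  by have := IH _ at_q; rewrite size_cat /= !addnS !addSn addnA.
- have /= at_while := at_a.
  have [_ _ /instrs_at_cat[at_p at_jump]] := instrs_at_cons at_while.
  have := reaches_jump (m := m1) at_while; rewrite test_r => to_body.
  have back := reaches_jump (m := m2) at_jump.
  apply: (@reaches_leq (1 + n1 + 1 + n2)); first by lia.
  apply: reaches_trans (IHwhile _ at_a).
  exact: reaches_trans (reaches_trans to_body (IHp _ at_p)) back.
- rewrite /= in at_a *; have := reaches_jump (m := m) at_a.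
  by rewrite (negbTE test_r) size_cat /= !addnS addn0 addSn.
- exact: reaches_leq (IHp _ at_a).
Qed.

End Simulation.

Lemma tm_step_halted M (c : config M) n :
  halting c.1 -> iter n (@tm_step M) c = c.
Proof. by move=> halt_c; elim: n => //= n ->; rewrite /tm_step halt_c. Qed.

Lemma computes_within_leq M x y n n' :
  n <= n' -> computes_within M x y n -> computes_within M x y n'.
Proof.
move=> le_n [halt_n out_n].
by rewrite /computes_within -(subnK le_n) iterD tm_step_halted.
Qed.

Lemma run_computes_within p x y m n :
  run p (Store x [::] [::] [::]) m n -> output m = y ->
  computes_within (instr_machine (compile p 0)) x y n.
Proof.
move=> run_p out_m; set instrs := compile p 0.
have at0 : instrs_at instrs 0 instrs.
  by exists [::] => //; exists [::]; rewrite cats0.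
pose tps := (tm_init (instr_machine instrs) x).2.
have [|n' [tps' [le_n rep_m iter_n]]] := compile_reaches run_p at0 (tps := tps).
  by move=> r; rewrite ffunE; exists 0; rewrite cats0; case: r.
have init_eq : tm_init (instr_machine instrs) x = (inord 0, tps).
  by congr pair; apply: val_inj; rewrite /= inordK.
apply: computes_within_leq le_n _; rewrite /computes_within init_eq iter_n /=.
split; first by apply/eqP/val_inj; rewrite /= add0n inordK.
have -> : ord_max = reg_tape Output by apply: val_inj.
by rewrite (holds_output (rep_m Output)).
Qed.

(** * Polynomial bounds *)

Section PolyBounded.

Variables (T : Type) (size_of : T -> nat).
Implicit Types g h : T -> nat.

(* Bounds of this shape absorb constants and are closed under sums, products and
   composition. *)
Definition poly_bounded g : Prop :=
  exists k, forall x, g x <= (size_of x).+2 ^ k.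

Lemma poly_bounded_leq h g :
  (forall x, g x <= h x) -> poly_bounded h -> poly_bounded g.
Proof.
by move=> le_gh [k le_h]; exists k => x; apply: leq_trans (le_gh x) (le_h x).
Qed.

Lemma poly_bounded_size : poly_bounded size_of.
Proof. by exists 1 => x; rewrite expn1; lia. Qed.

Lemma poly_bounded_const n : poly_bounded (fun _ => n).
Proof.
exists n => x; apply: leq_trans (ltnW (ltn_expl n (isT : 1 < 2))) _.
by case: n => // n; rewrite leq_exp2r.
Qed.

Lemma poly_boundedM g h :
  poly_bounded g -> poly_bounded h -> poly_bounded (fun x => g x * h x).
Proof.
by move=> [i le_g] [j le_h]; exists (i + j) => x; rewrite expnD leq_mul.
Qed.

Lemma poly_boundedD g h :
  poly_bounded g -> poly_bounded h -> poly_bounded (fun x => g x + h x).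
Proof.
move=> [i le_g] [j le_h]; exists (i + j).+1 => x.
rewrite expnS expnD; have := le_g x; have := le_h x.
have: 0 < (size_of x).+2 ^ i by rewrite expn_gt0.
have: 0 < (size_of x).+2 ^ j by rewrite expn_gt0.
move: (_ ^ i) (_ ^ j) => u v v_gt0 u_gt0 le_hv le_gu.
have : 2 * (u * v) <= (size_of x).+2 * (u * v) by rewrite leq_mul.
by nia.
Qed.

Lemma poly_boundedX g k : poly_bounded g -> poly_bounded (fun x => g x ^ k).
Proof.
move=> bound_g; elim: k => [|k IHk]; first exact: poly_bounded_const 1.
by apply: poly_bounded_leq (poly_boundedM bound_g IHk) => x; rewrite expnS.
Qed.

End PolyBounded.

Lemma poly_bounded_comp (T U : Type) (sizeT : T -> nat) (sizeU : U -> nat)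
    (g : U -> nat) (f : T -> U) :
  poly_bounded sizeU g -> poly_bounded sizeT (fun x => sizeU (f x)) ->
  poly_bounded sizeT (fun x => g (f x)).
Proof.
move=> [k le_g] bound_f; apply: poly_bounded_leq (fun x => le_g (f x)) _.
apply: poly_boundedX.
apply: poly_bounded_leq (poly_boundedD bound_f (poly_bounded_const _ 2)) => x.
by rewrite addn2.
Qed.

Ltac poly_bound :=
  do ?[assumption | apply: poly_bounded_const | apply: poly_bounded_size
      | apply: poly_boundedD | apply: poly_boundedM | apply: poly_boundedX].

Lemma poly_bounded_horner (p : {poly nat}) : poly_bounded id (fun n => p.[n]%R).
Proof.
elim/poly_ind: p => [|p c IHp].
  by apply: poly_bounded_leq (poly_bounded_const _ 0) => n; rewrite horner0.
apply: (@poly_bounded_leq _ _ (fun n => p.[n]%R * n + c)); last by poly_bound.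
by move=> n; rewrite hornerMXaddC.
Qed.

Lemma polytimeP f :
  polytime f <-> exists M g, poly_bounded size g /\
                   forall x, computes_within M x (f x) (g x).
Proof.
split=> [[M [p Mp]]|[M [g [[k le_g] Mg]]]]; exists M.
  exists (fun x => p.[size x]%R); split=> //.
  exact: (poly_bounded_comp (poly_bounded_horner p)) (poly_bounded_size _).
exists (('X + 2%:R%:P) ^+ k)%R => x; apply: computes_within_leq (Mg x).
rewrite horner_exp hornerD hornerX hornerC; apply: leq_trans (le_g x) _.
rewrite -[(_ + _)%R]/(size x + 2)%N addn2.
by elim: k {le_g} => // k IHk; rewrite exprS expnS leq_mul2l IHk orbT.
Qed.

Lemma eq_polytime f g : f =1 g -> polytime f -> polytime g.
Proof. by move=> eq_fg [M [p Mp]]; exists M, p => x; rewrite -eq_fg. Qed.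

(** * Composition of machines *)

Definition eq_tape (t u : tape) : Prop :=
  nth None t.1 =1 nth None u.1 /\ nth None t.2 =1 nth None u.2.

Lemma eq_tape_refl t : eq_tape t t. Proof. by []. Qed.

Lemma eq_tape_trans t u v : eq_tape t u -> eq_tape u v -> eq_tape t v.
Proof. by move=> [eq_l eq_r] [? ?]; split=> n; rewrite ?eq_l ?eq_r. Qed.

Lemma eq_tape_read t u : eq_tape t u -> tape_read t = tape_read u.
Proof. by case=> _ eq_r; rewrite /tape_read -!nth0 eq_r. Qed.

Lemma eq_tape_write s t u :
  eq_tape t u -> eq_tape (tape_write s t) (tape_write s u).
Proof. by move=> [eq_l eq_r]; split=> //= -[|n] //=; rewrite !nth_behead. Qed.

Lemma eq_tape_move d t u :
  eq_tape t u -> eq_tape (tape_move d t) (tape_move d u).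
Proof.
by move=> [eq_l eq_r]; case: d => [[]|] //; split=> -[|n] //=;
  rewrite ?nth_behead ?eq_l ?eq_r // -!nth0 ?eq_l ?eq_r.
Qed.

Lemma eq_tape_touch t u : eq_tape t u -> eq_tape (touch t) u.
Proof.
by apply: eq_tape_trans; case: t => l [|s r]; split=> //= -[|[]].
Qed.

Lemma eq_tape_output t u : eq_tape t u -> tape_output t = tape_output u.
Proof.
rewrite /tape_output; case: t u => [_ r1] [_ r2] [/= _].
elim: r1 r2 => [|s r1 IH] [|s' r2] //= eq_r.
- by move: (eq_r 0) => /= <-.
- by move: (eq_r 0) => /= ->.
- move: (eq_r 0) => /= <-; case: s {eq_r}(fun n => eq_r n.+1) => //= b eq_r.
  by rewrite (IH r2).
Qed.

Lemma tape_output_prefix tp :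
  exists2 rest, tp.2 = map Some (tape_output tp) ++ rest &
                head None rest = None.
Proof.
rewrite /tape_output; case: tp => _ /=; elim=> [|[b|] r [rest eq_r blank]] /=.
- by exists [::].
- by exists rest; rewrite // {1}eq_r.
- by exists (None :: r).
Qed.

Lemma tm_step_tape_size M (c : config M) i :
  size ((tm_step c).2 i).2 <= (size (c.2 i).2).+2.
Proof.
rewrite /tm_step; case: ifP => [_|_]; first by lia.
rewrite /= ffunE; case: (_ i) => s [[]|] /=; rewrite size_behead; lia.
Qed.

Lemma computes_within_size M x y n :
  computes_within M x y n -> size y <= size x + n.*2.
Proof.
move=> [_ <-].
set out := _ ord_max; have [rest out_eq _] := tape_output_prefix out.
apply: (@leq_trans (size out.2)).
  by rewrite out_eq size_cat size_map leq_addr.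
rewrite {rest out_eq}/out; elim: n => [|n IHn] /=.
  by rewrite ffunE; case: ifP; rewrite /= ?size_map; lia.
by apply: leq_trans (tm_step_tape_size _ _) _; lia.
Qed.

Section Composition.

Variables M N : turing_machine.

Let m := extra_tapes M.
Let n := extra_tapes N.

Definition fst_tape (i : 'I_m.+1) : 'I_(m.+1 + n.+1) := lshift n.+1 i.
Definition snd_tape (i : 'I_n.+1) : 'I_(m.+1 + n.+1) := rshift m.+1 i.

Definition comp_state : finType := (state M + (bool + state N))%type.

(* The output of [M] is copied to the input tape of [N], which is then
   rewound. *)
Notation running_fst q := (inl q).
Notation copying := (inr (inl false)).
Notation rewinding := (inr (inl true)).
Notation running_snd q := (inr (inr q)).

Definition comp_transition (q : comp_state)
    (scanned : {ffun 'I_(m.+1 + n.+1) -> symbol}) :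
    comp_state * {ffun 'I_(m.+1 + n.+1) -> symbol * direction} :=
  let shift d :=
    [ffun j => (scanned j, if j == snd_tape ord0 then d else None)] in
  match q with
  | running_fst q =>
      if halting q then (copying, shift None) else
      let a := transition q [ffun i => scanned (fst_tape i)] in
      (running_fst a.1, [ffun j => match split j with
                                   | inl i => a.2 i
                                   | inr _ => (scanned j, None)
                                   end])
  | copying =>
      if scanned (fst_tape ord_max) is Some b then
        (copying, [ffun j => if (j == fst_tape ord_max) || (j == snd_tape ord0)
                             then (Some b, Some true) else (scanned j, None)])
      else (rewinding, shift (Some false))
  | rewinding =>
      if scanned (snd_tape ord0) is Some b then (rewinding, shift (Some false))
      else (running_snd (start N), shift (Some true))
  | running_snd q =>
      let a := transition q [ffun i => scanned (snd_tape i)] in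
      (running_snd a.1, [ffun j => match split j with
                                   | inl _ => (scanned j, None)
                                   | inr i => a.2 i
                                   end])
  end.

Definition comp_machine : turing_machine :=
  @TuringMachine (m + n.+1) comp_state (running_fst (start M))
    (fun q => if q is running_snd q' then halting q' else false)
    comp_transition.

Let step := @tm_step comp_machine.

Lemma split_fst_tape i : split (fst_tape i) = inl i.
Proof. exact: (unsplitK (inl _ i)). Qed.

Lemma split_snd_tape i : split (snd_tape i) = inr i.
Proof. exact: (unsplitK (inr _ i)). Qed.

Lemma snd_tape_inj : injective snd_tape.
Proof. exact: rshift_inj. Qed.

Lemma snd_tape_neq_fst i j : (snd_tape i == fst_tape j) = false.
Proof. by apply/eqP => /(congr1 val) /=; have := ltn_ord j; lia. Qed.

Definition snd_tapes (tps : {ffun 'I_(m.+1 + n.+1) -> tape})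
    (tps2 : 'I_n.+1 -> tape) : Prop :=
  forall i, eq_tape (tps (snd_tape i)) (tps2 i).

Definition input_only (tp : tape) (i : 'I_n.+1) : tape :=
  if i == ord0 then tp else ([::], [::]).

Lemma snd_tapes_input (tps tps' : {ffun 'I_(m.+1 + n.+1) -> tape}) tp tp' :
  snd_tapes tps (input_only tp) -> eq_tape (tps' (snd_tape ord0)) tp' ->
  (forall i, i != ord0 -> tps' (snd_tape i) = touch (tps (snd_tape i))) ->
  snd_tapes tps' (input_only tp').
Proof.
move=> old_tps new_input new_rest i; rewrite /input_only.
case: (eqVneq i ord0) => [->//|i_neq0]; rewrite new_rest //.
by apply: eq_tape_touch; have := old_tps i; rewrite /input_only (negbTE i_neq0).
Qed.

Definition simulates_fst (c : config comp_machine) (d : config M) : Prop :=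
  [/\ c.1 = running_fst d.1, forall i, c.2 (fst_tape i) = d.2 i &
      snd_tapes c.2 (input_only ([::], [::]))].

Lemma simulates_fst_step c d :
  simulates_fst c d -> ~~ halting d.1 -> simulates_fst (step c) (tm_step d).
Proof.
case: c => q tps [/= -> tps_fst tps_snd] not_halted.
rewrite /step /tm_step /= (negbTE not_halted).
have -> : [ffun i => [ffun j => tape_read (tps j)] (fst_tape i)] =
          [ffun i => tape_read (d.2 i)].
  by apply/ffunP => i; rewrite !ffunE tps_fst.
split=> //= i; rewrite !ffunE ?split_fst_tape ?split_snd_tape ?tps_fst //.
exact: eq_tape_touch.
Qed.

Lemma simulates_fst_iter x k : exists2 j, j <= k &
  simulates_fst (iter j step (tm_init comp_machine x))
                (iter k (@tm_step M) (tm_init M x)).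
Proof.
elim: k => [|k [j le_jk sim_j]].
  exists 0 => //; split=> //= i; rewrite !ffunE.
    by congr (tape_input (if _ then _ else _));
      apply/eqP/eqP => /(congr1 val) /= eq0; apply: val_inj.
  by rewrite /input_only; case: ifP.
case: (boolP (halting (iter k (@tm_step M) (tm_init M x)).1)) => halted.
  by exists j; [lia | rewrite /= {1}/tm_step halted].
by exists j.+1 => //=; apply: simulates_fst_step.
Qed.

Definition handing_over (q : comp_state) (tp : tape) (c : config comp_machine) :
    Prop :=
  c.1 = q /\ snd_tapes c.2 (input_only tp).

Lemma copying_run w rest c done :
  handing_over copying (map Some done, [::]) c ->
  (c.2 (fst_tape ord_max)).2 = map Some w ++ rest -> head None rest = None ->
  handing_over rewinding
    (tape_move (Some false) (map Some (catrev w done), [::]))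
    (iter (size w).+1 step c).
Proof.
move=> hand out_eq blank; elim: w c done hand out_eq => [|b w IHw] [q tps] done
  [/= -> tps_snd] out_eq.
  rewrite /step /tm_step /= ffunE /tape_read out_eq blank /=; split=> //=.
  apply: (snd_tapes_input tps_snd) => [|i i_neq0]; rewrite !ffunE.
    rewrite eqxx.
    exact: (eq_tape_move (Some false) (eq_tape_touch (tps_snd ord0))).
  by rewrite (inj_eq snd_tape_inj) (negbTE i_neq0).
rewrite -!iterS iterSr /step /tm_step /= ffunE /tape_read out_eq /=.
apply: IHw; last by rewrite !ffunE eqxx /= out_eq.
split=> //=; apply: (snd_tapes_input tps_snd) => [|i i_neq0]; rewrite !ffunE.
  rewrite eqxx orbT /=.
  have := eq_tape_move (Some true) (eq_tape_write (Some b) (tps_snd ord0)).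
  by case=> eq_l eq_r; split=> k; rewrite ?eq_l ?eq_r.
by rewrite (inj_eq snd_tape_inj) (negbTE i_neq0) snd_tape_neq_fst.
Qed.

Lemma rewinding_run l c v :
  handing_over rewinding
    (tape_move (Some false) (map Some l, map Some v)) c ->
  handing_over (running_snd (start N)) ([::], map Some (catrev l v))
    (iter (size l).+1 step c).
Proof.
elim: l c v => [|b l IHl] [q tps] v [/= -> tps_snd].
  rewrite /step /tm_step /= ffunE (eq_tape_read (tps_snd ord0)) /=; split=> //=.
  apply: (snd_tapes_input tps_snd) => [|i i_neq0]; rewrite !ffunE.
    rewrite eqxx; apply: eq_tape_trans.
      exact: (eq_tape_move (Some true) (eq_tape_touch (tps_snd ord0))).
    by split=> //= -[|[]].
  by rewrite (inj_eq snd_tape_inj) (negbTE i_neq0).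
rewrite -!iterS iterSr; apply: (IHl _ (b :: v)).
rewrite /step /tm_step /= ffunE (eq_tape_read (tps_snd ord0)) /=; split=> //=.
apply: (snd_tapes_input tps_snd) => [|i i_neq0]; rewrite !ffunE.
  rewrite eqxx.
  exact: (eq_tape_move (Some false) (eq_tape_touch (tps_snd ord0))).
by rewrite (inj_eq snd_tape_inj) (negbTE i_neq0).
Qed.

Definition simulates_snd (c : config comp_machine) (d : config N) : Prop :=
  c.1 = running_snd d.1 /\ snd_tapes c.2 d.2.

Lemma simulates_fst_halted c d y :
  simulates_fst c d -> halting d.1 -> tape_output (d.2 ord_max) = y ->
  simulates_snd (iter ((size y).*2 + 3) step c) (tm_init N y).
Proof.
move=> [q_eq tps_fst tps_snd] halted out_y.
have copy0 : handing_over copying ([::], [::]) (step c).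
  rewrite /step /tm_step q_eq /= halted; split=> //=.
  apply: (snd_tapes_input tps_snd) => [|i i_neq0]; rewrite !ffunE.
    by rewrite eqxx; exact: eq_tape_touch (tps_snd ord0).
  by rewrite (inj_eq snd_tape_inj) (negbTE i_neq0).
have [rest out_eq blank] := tape_output_prefix (touch (d.2 ord_max)).
rewrite (eq_tape_output (eq_tape_touch (eq_tape_refl _))) out_y in out_eq.
have out_step : (step c).2 (fst_tape ord_max) = touch (d.2 ord_max).
  rewrite /step /tm_step q_eq /= halted !ffunE tps_fst eq_sym.
  by rewrite snd_tape_neq_fst.
rewrite -out_step in out_eq.
have copied := copying_run (done := [::]) copy0 out_eq blank.
have := rewinding_run (v := [::]) copied.
rewrite !catrevE !cats0 revK size_rev -!iterD -iterSr.
rewrite (_ : _.+1 = (size y).*2 + 3); last by lia.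
case=> state_eq tps_snd'; split=> //= i.
by have := tps_snd' i; rewrite /input_only ffunE; case: ifP.
Qed.

Lemma simulates_snd_step c d :
  simulates_snd c d -> simulates_snd (step c) (tm_step d).
Proof.
case: c => q tps [/= -> tps_snd]; rewrite /step /tm_step /=.
case: ifP => // _.
have -> : [ffun i => [ffun j => tape_read (tps j)] (snd_tape i)] =
          [ffun i => tape_read (d.2 i)].
  by apply/ffunP => i; rewrite !ffunE; apply: eq_tape_read.
split=> //= i; rewrite !ffunE split_snd_tape.
by apply: eq_tape_move; apply: eq_tape_write.
Qed.

Lemma comp_machine_computes x y z k l :
  computes_within M x y k -> computes_within N y z l ->
  computes_within comp_machine x z (l + ((size y).*2 + 3 + k)).
Proof.
move=> [haltedM out_y] [haltedN out_z].
have [j le_jk /simulates_fst_halted sim_y] := simulates_fst_iter x k.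
have {sim_y} sim0 := sim_y _ haltedM out_y.
have [state_z tps_z] : simulates_snd
    (iter (l + ((size y).*2 + 3 + j)) step (tm_init comp_machine x))
    (iter l (@tm_step N) (tm_init N y)).
  rewrite iterD [in X in simulates_snd X]iterD.
  by elim: {haltedN out_z} l => //= l; apply: simulates_snd_step.
apply: (@computes_within_leq _ _ _ (l + ((size y).*2 + 3 + j))).
  by rewrite !leq_add2l.
rewrite /computes_within -/step {1}/halting /= state_z; split=> //.
have -> : ord_max = snd_tape ord_max by apply: val_inj; exact: (addnS m n).
by rewrite (eq_tape_output (tps_z _)).
Qed.

End Composition.

Lemma polytime_comp f g : polytime f -> polytime g -> polytime (g \o f).
Proof.
move=> /polytimeP[M [s [bound_s Ms]]] /polytimeP[N [t [bound_t Nt]]].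
have bound_f : poly_bounded size (fun x => size (f x)).
  apply: (@poly_bounded_leq _ _ (fun x => size x + 2 * s x)) => [x|].
    by rewrite mul2n; apply: computes_within_size (Ms x).
  by poly_bound.
have bound_tf := poly_bounded_comp bound_t bound_f.
apply/polytimeP; exists (comp_machine M N).
exists (fun x => t (f x) + (2 * size (f x) + 3 + s x)); split=> [|x].
  by poly_bound.
by rewrite mul2n; apply: comp_machine_computes (Ms x) (Nt (f x)).
Qed.

(** * Trees on the stack *)

Definition is_one : pred symbol := pred1 (Some true).

Definition drain (r : reg) (action : bool -> prog) : prog :=
  While r isSome
    (If r is_one (Pop r ;; action true) (Pop r ;; action false)).

(* [inv done w] is the store when [w] is left and [done] has been read, last bit
   first. *)
Lemma run_drain r action n (inv : bits -> bits -> store) :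
  (forall done w, get (inv done w) r = w) ->
  (forall done b w,
     run (action b) (put r w (inv done (b :: w))) (inv (b :: done) w) n) ->
  forall w done,
  run (drain r action) (inv done w) (inv (catrev w done) [::])
    ((n + 5) * size w).+1.
Proof.
move=> get_inv run_action; elim=> [|b w IHw] done /=.
  by rewrite muln0; apply: run_while_end; rewrite get_inv.
rewrite mulnS; apply: run_leq; last first.
  apply: run_while (IHw (b :: done)); first by rewrite get_inv.
  apply: run_if; rewrite get_inv /=.
  have := run_pop r (inv done (b :: w)); rewrite get_inv /= => run_popped.
  case: b run_action run_popped => run_action run_popped;
    exact: run_seq run_popped (run_action _ _ _).
by lia.
Qed.

Definition transfer (src dst : reg) : prog := drain src (Push dst).

Lemma run_transfer src dst m : src <> dst ->
  run (transfer src dst) m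
    (put src [::] (put dst (catrev (get m src) (get m dst)) m))
    (7 * size (get m src)).+1.
Proof.
move=> neq_reg; pose inv done w := put src w (put dst done m).
have {1}-> : m = inv (get m dst) (get m src).
  by rewrite /inv !put_get.
apply: (@run_drain _ _ 2 inv) => [done w|done b w]; rewrite /inv.
  by rewrite get_put eqxx.
set m1 := put src w _.
suff -> : put src w (put dst (b :: done) m) = put dst (b :: get m1 dst) m1.
  exact: run_push.
by rewrite /m1; case: src dst neq_reg {m1 inv} => [] [].
Qed.

Definition push_word (w : bits) : prog :=
  foldr (fun b p => p ;; Push Work b) Skip w.

Lemma run_push_word w u s t n :
  run (push_word w) (Store u s t n) (Store u (w ++ s) t n) (2 * size w).
Proof.
elim: w => [|b w IHw] /=; first exact: run_skip.
by rewrite mulnS addnC; apply: run_seq IHw _; apply: run_push.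
Qed.

Inductive tree := Leaf | Node (t u : tree).

Fixpoint tree_code (t : tree) : bits :=
  if t is Node t1 t2 then true :: tree_code t1 ++ tree_code t2 else [:: false].

Lemma size_tree_code_gt0 t : 0 < size (tree_code t). Proof. by case: t. Qed.

(* [Output] counts, in unary, the subtrees that remain to be read. *)
Definition pop_subtrees (r : reg) : prog :=
  While Output isSome
    (If Work is_one
      (Pop Work ;; Push r true ;; Push Output true)
      (Pop Work ;; Push r false ;; Pop Output)).

Definition pop_tree (r : reg) : prog := Push Output true ;; pop_subtrees r.

Lemma run_pop_subtrees r a : r = Scratch \/ r = Input -> forall u s t n m' k,
  run (pop_subtrees r)
    (put r (rev (tree_code a) ++ get (Store u s t n) r) (Store u s t n)) m' k ->
  run (pop_subtrees r) (Store u (tree_code a ++ s) t (true :: n)) m'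
    (k + 9 * size (tree_code a)).
Proof.
move=> r_free; elim: a => [|a1 IH1 a2 IH2] u s t n m' k run_rest.
  apply: run_leq; last first.
    apply: run_while run_rest => //; apply: run_if => /=.
    apply: run_seq (run_pop _ _) _; apply: run_seq (run_push _ _ _) _.
    by case: r_free => ->; apply: run_pop.
  by rewrite /=; lia.
apply: run_leq; last first.
  apply: (run_while (m2 := put r (true :: get (Store u s t n) r)
    (Store u (tree_code a1 ++ tree_code a2 ++ s) t (true :: true :: n)))) => //.
    apply: run_if => /=.
    apply: run_seq (run_pop _ _) _; apply: run_seq (run_push _ _ _) _.
    by rewrite /= -catA; case: r_free => ->; apply: run_push.
  case: r_free IH1 IH2 run_rest => -> IH1 IH2 run_rest /=;
    apply: IH1; apply: IH2; move: run_rest;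
    by rewrite /= rev_cons rev_cat cat_rcons -catA; apply.
by rewrite /= size_cat; lia.
Qed.

Lemma run_pop_tree r a u s t : r = Scratch \/ r = Input ->
  run (pop_tree r) (Store u (tree_code a ++ s) t [::])
    (put r (rev (tree_code a) ++ get (Store u s t [::]) r) (Store u s t [::]))
    (12 * size (tree_code a)).
Proof.
move=> r_free; apply: run_leq; last first.
  apply: run_seq (run_push _ _ _) _; apply: run_pop_subtrees => //.
  by apply: run_while_end; case: r_free => ->.
by have := size_tree_code_gt0 a; lia.
Qed.

Definition on_work (s : bits) : store := Store [::] s [::] [::].

Lemma run_push_work b s : run (Push Work b) (on_work s) (on_work (b :: s)) 2.
Proof. exact: run_push. Qed.

Lemma run_pop_work b s : run (Pop Work) (on_work (b :: s)) (on_work s) 1.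
Proof. exact: run_pop. Qed.

Definition drop_tree : prog := pop_tree Input ;; drain Input (fun _ => Skip).

Lemma run_drop_tree a s :
  run drop_tree (on_work (tree_code a ++ s)) (on_work s)
    (18 * size (tree_code a)).
Proof.
apply: run_leq; last first.
  apply: run_seq; first by apply: run_pop_tree; right.
  pose inv (_ w : bits) := Store w s [::] [::].
  apply: (@run_drain Input _ 0 inv _ _ _ [::]) => // *; exact: run_skip.
by rewrite cats0 size_rev; have := size_tree_code_gt0 a; lia.
Qed.

Lemma run_push_back src w m : src <> Work -> get m src = rev w ->
  run (transfer src Work) m (put src [::] (put Work (w ++ work m) m))
    (7 * size w).+1.
Proof.
move=> src_Work src_w; have := run_transfer m src_Work.
by rewrite src_w catrevE revK size_rev.
Qed.

Definition swap_trees : prog :=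
  pop_tree Scratch ;; pop_tree Input ;;
  transfer Scratch Work ;; transfer Input Work.

Lemma run_swap_trees a b s :
  run swap_trees (on_work (tree_code a ++ tree_code b ++ s))
    (on_work (tree_code b ++ tree_code a ++ s))
    (21 * (size (tree_code a) + size (tree_code b))).
Proof.
apply: run_leq; last first.
  apply: run_seq; first by apply: run_pop_tree; left.
  apply: run_seq; first by apply: run_pop_tree; right.
  rewrite /= !cats0.
  apply: run_seq; first by apply: (@run_push_back Scratch (tree_code a)).
  by apply: (@run_push_back Input (tree_code b)).
have := size_tree_code_gt0 a; have := size_tree_code_gt0 b; lia.
Qed.

Definition dup_tree : prog :=
  pop_tree Scratch ;; drain Scratch (fun b => Push Work b ;; Push Input b) ;;
  transfer Input Scratch ;; transfer Scratch Work.

Lemma run_dup_tree a s :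
  run dup_tree (on_work (tree_code a ++ s))
    (on_work (tree_code a ++ tree_code a ++ s)) (40 * size (tree_code a)).
Proof.
have run_copy : run (drain Scratch (fun b => Push Work b ;; Push Input b))
    (Store [::] s (rev (tree_code a)) [::])
    (Store (tree_code a) (tree_code a ++ s) [::] [::])
    (9 * size (tree_code a)).+1.
  have := @run_drain Scratch (fun b => Push Work b ;; Push Input b) 4
    (fun done w => Store done (done ++ s) w [::]) (fun _ _ => erefl)
    (fun _ _ _ => run_seq (run_push _ _ _) (run_push _ _ _))
    (rev (tree_code a)) [::].
  by rewrite catrevE revK cats0 size_rev.
have run_reverse : run (transfer Input Scratch)
    (Store (tree_code a) (tree_code a ++ s) [::] [::])
    (Store [::] (tree_code a ++ s) (rev (tree_code a)) [::])
    (7 * size (tree_code a)).+1.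
  exact: (@run_transfer Input Scratch (Store _ _ [::] _)).
apply: run_leq; last first.
  apply: run_seq; first by apply: run_pop_tree; left.
  rewrite /= cats0; apply: run_seq run_copy _; apply: run_seq run_reverse _.
  by apply: (@run_push_back Scratch (tree_code a)).
have := size_tree_code_gt0 a; lia.
Qed.

(** * Functions computable in polynomial time *)

Structure encType := EncType { enc_sort :> Type; tree_of : enc_sort -> tree }.

Arguments tree_of {_} _.

Definition tree_of_bool (b : bool) : tree := if b then Node Leaf Leaf else Leaf.

Canonical unit_encType := EncType (fun _ : unit => Leaf).
Canonical bool_encType := EncType tree_of_bool.
Canonical nat_encType := EncType (fun n : nat => iter n (Node Leaf) Leaf).
Canonical prod_encType (A B : encType) :=
  EncType (fun x : A * B => Node (tree_of x.1) (tree_of x.2)).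
Canonical seq_encType (A : encType) :=
  EncType (foldr (fun x : A => Node (tree_of x)) Leaf).

Definition code {A : encType} (x : A) : bits := tree_code (tree_of x).

Definition code_size {A : encType} (x : A) : nat := size (code x).

Section Codes.

Context {A B : encType}.

Lemma cat_code_pair (x : A) (y : B) s :
  code (x, y) ++ s = true :: code x ++ code y ++ s.
Proof. by rewrite /code /= -catA. Qed.

Lemma code_size_gt0 (x : A) : 0 < code_size x.
Proof. exact: size_tree_code_gt0. Qed.

Lemma code_size_pair (x : A) (y : B) :
  code_size (x, y) = (code_size x + code_size y).+1.
Proof. by rewrite /code_size /code /= size_cat. Qed.

Lemma code_size_cons (x : A) l :
  code_size (x :: l) = (code_size x + code_size l).+1.
Proof. by rewrite /code_size /code /= size_cat. Qed.

Lemma code_size_cat (k l : seq A) :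
  (code_size (k ++ l)).+1 = code_size k + code_size l.
Proof. by elim: k => //= x k IHk; rewrite !code_size_cons; lia. Qed.

Lemma size_lt_code_size (l : seq A) : size l < code_size l.
Proof. by elim: l => //= x l IHl; rewrite code_size_cons; lia. Qed.

End Codes.

Definition FP {A B : encType} (f : A -> B) : Prop :=
  exists p g, poly_bounded code_size g /\
  forall x s, run p (on_work (code x ++ s)) (on_work (code (f x) ++ s)) (g x).

Definition FP2 {A B C : encType} (f : A -> B -> C) : Prop :=
  FP (fun x : A * B => f x.1 x.2).

Definition FP3 {A B C D : encType} (f : A -> B -> C -> D) : Prop :=
  FP (fun x : A * B * C => f x.1.1 x.1.2 x.2).

Lemma FP_code_size {A B : encType} (f : A -> B) :
  FP f -> poly_bounded code_size (fun x => code_size (f x)).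
Proof.
move=> [p [g [bound_g run_p]]].
apply: (@poly_bounded_leq _ _ (fun x => code_size x + g x)) => [x|].
  have := run_store_size (run_p x [::]).
  by rewrite /store_size /= !cats0 -/(code_size x) -/(code_size (f x)); lia.
by poly_bound.
Qed.

Lemma FP_ext {A B C : encType} (g : A -> C) (f : A -> B) :
  (forall x, code (f x) = code (g x)) -> FP f -> FP g.
Proof.
move=> eq_fg [p [t [bound_t run_p]]]; exists p, t; split=> // x s.
by rewrite -eq_fg.
Qed.

Lemma FP_id {A : encType} : FP (fun x : A => x).
Proof.
exists Skip, (fun _ => 0); split=> [|x s]; first by poly_bound.
exact: run_skip.
Qed.

Lemma FP_const {A B : encType} (y : B) : FP (fun _ : A => y).
Proof.
exists (drop_tree ;; push_word (code y)).
exists (fun x => 18 * code_size x + 2 * code_size y).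
split=> [|x s]; first by poly_bound.
exact: run_seq (run_drop_tree _ _) (run_push_word _ _ _ _ _).
Qed.

Lemma FP_comp {A B C : encType} (g : B -> C) (f : A -> B) :
  FP g -> FP f -> FP (fun x => g (f x)).
Proof.
move=> [q [t [bound_t run_q]]] fp_f; have [p [s [bound_s run_p]]] := fp_f.
exists (p ;; q), (fun x => s x + t (f x)); split=> [|x rest].
  apply: poly_boundedD => //.
  exact: poly_bounded_comp bound_t (FP_code_size fp_f).
exact: run_seq (run_p x rest) (run_q _ rest).
Qed.

Lemma FP_pair {A B C : encType} (f : A -> B) (g : A -> C) :
  FP f -> FP g -> FP (fun x => (f x, g x)).
Proof.
move=> fp_f fp_g; have size_f := FP_code_size fp_f.
have size_g := FP_code_size fp_g; move: fp_f fp_g.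
move=> [p [s [bound_s run_p]]] [q [t [bound_t run_q]]].
exists (dup_tree ;; p ;; swap_trees ;; q ;; swap_trees ;; Push Work true).
exists (fun x => 40 * code_size x + (s x + (21 * (code_size (f x) + code_size x)
  + (t x + (21 * (code_size (g x) + code_size (f x)) + 2))))).
split=> [|x rest]; first by poly_bound.
apply: run_seq (run_dup_tree _ _) _; apply: run_seq (run_p x _) _.
apply: run_seq (run_swap_trees _ _ _) _; apply: run_seq (run_q x _) _.
apply: run_seq (run_swap_trees _ _ _) _; rewrite cat_code_pair.
exact: run_push_work.
Qed.

Lemma FP_fst {A B : encType} : FP (@fst A B).
Proof.
exists (Pop Work ;; swap_trees ;; drop_tree), (fun x => 1 + 39 * code_size x).
split=> [|[x y] s]; first by poly_bound.
rewrite cat_code_pair; apply: run_seq (run_pop_work _ _) _.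
apply: run_leq (run_seq (run_swap_trees _ _ _) (run_drop_tree _ _)).
by rewrite code_size_pair /code_size /code; lia.
Qed.

Lemma FP_snd {A B : encType} : FP (@snd A B).
Proof.
exists (Pop Work ;; drop_tree), (fun x => 1 + 18 * code_size x).
split=> [|[x y] s]; first by poly_bound.
rewrite cat_code_pair; apply: run_seq (run_pop_work _ _) _.
apply: run_leq (run_drop_tree _ _).
by rewrite code_size_pair /code_size /code; lia.
Qed.

Lemma FP2_comp {A B C D : encType} (h : B -> C -> D) (f : A -> B) (g : A -> C) :
  FP2 h -> FP f -> FP g -> FP (fun x => h (f x) (g x)).
Proof.
move=> fp_h fp_f fp_g.
exact: (FP_comp (g := fun z => h z.1 z.2) fp_h (FP_pair fp_f fp_g)).
Qed.

Lemma FP3_comp {A B C D E : encType} (h : B -> C -> D -> E)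
    (f : A -> B) (g : A -> C) (k : A -> D) :
  FP3 h -> FP f -> FP g -> FP k -> FP (fun x => h (f x) (g x) (k x)).
Proof.
move=> fp_h fp_f fp_g fp_k.
exact: (FP_comp (g := fun z => h z.1.1 z.1.2 z.2) fp_h
  (FP_pair (FP_pair fp_f fp_g) fp_k)).
Qed.

Lemma FP_cons {A : encType} : FP2 (@cons A).
Proof. exact: (FP_ext _ FP_id). Qed.

Create HintDb fp.
#[global] Hint Resolve FP_id FP_fst FP_snd FP_cons : fp.

(* Extended below with the combinators. *)
Ltac fp_combinator := fail.

Ltac fp_step :=
  cbv beta;
  match goal with
  | |- FP2 _ => rewrite /FP2
  | |- FP3 _ => rewrite /FP3
  | |- FP _ => solve [auto 2 with fp]
  | |- FP (fun _ => ?y) => exact: FP_const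
  | |- FP (fun x => (@?f x, @?g x)) => apply: (FP_pair (f := f) (g := g))
  | |- FP (fun x => ?h (@?f x)) =>
      apply: (FP_comp (g := h) (f := f)); [solve [auto 2 with fp] |]
  | |- FP (fun x => ?h (@?f x) (@?g x)) =>
      apply: (FP2_comp (h := h) (f := f) (g := g)); [solve [auto 2 with fp] | |]
  | |- FP (fun x => ?h (@?f x) (@?g x) (@?k x)) =>
      apply: (FP3_comp (h := h) (f := f) (g := g) (k := k));
        [solve [auto 2 with fp] | | |]
  | |- FP _ => fp_combinator
  end.

Ltac fp := repeat fp_step.

(* The code of a nonempty list is that of the pair of its head and tail. *)
Lemma FP_list_case {A B C : encType} (l : A -> seq B) (f : A -> C)
    (g : A -> B -> seq B -> C) :
  FP l -> FP f -> FP3 g ->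
  FP (fun x => if l x is y :: l' then g x y l' else f x).
Proof.
move=> fp_l [pf [tf [bound_tf run_f]]] fp_g.
have [pg [tg [[k le_tg] run_g]]] :
  FP (fun z : A * (B * seq B) => g z.1 z.2.1 z.2.2) by fp.
have size_l := FP_code_size fp_l; case: fp_l => pl [tl [bound_tl run_l]].
exists (dup_tree ;; pl ;;
  If Work is_one (swap_trees ;; Push Work true ;; pg) (drop_tree ;; pf)).
exists (fun x => 40 * code_size x + (tl x +
  (21 * (code_size (l x) + code_size x) + 18 +
   (code_size x + code_size (l x) + 3) ^ k + tf x + 4))).
split=> [|x s]; first by poly_bound.
apply: run_seq (run_dup_tree _ _) _; apply: run_seq (run_l x _) _.
rewrite addn4; apply: run_if; case: (l x) => [|y l'] /=.
  apply: run_leq (run_seq (@run_drop_tree Leaf _) (run_f x s)).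
  by rewrite /=; lia.
apply: run_leq; last first.
  apply: run_seq (@run_swap_trees (tree_of (y :: l')) _ _) _.
  apply: run_seq (run_push_work _ _) _; have := run_g (x, (y, l')) s.
  by rewrite cat_code_pair; apply.
have := le_tg (x, (y, l')).
rewrite code_size_pair -[code_size (y, l')]/(code_size (y :: l')) addn3.
rewrite -/(code_size x) -/(code_size (y :: l')); lia.
Qed.

Definition fold_loop (p : prog) : prog :=
  While Work is_one (Push Work true ;; p ;; Pop Work).

Lemma run_fold_loop {B C : encType} p (step : C -> B -> C) n (l : seq B) c s :
  (forall l1 b l2, l = l1 ++ b :: l2 ->
     run p (on_work (code (b :: l2, foldl step c l1) ++ s))
       (on_work (code (l2, foldl step c (rcons l1 b)) ++ s)) n) ->
  run (fold_loop p) (on_work (code l ++ code c ++ s))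
    (on_work (false :: code (foldl step c l) ++ s)) (size l * (n + 5) + 1).
Proof.
move=> run_p; suff run_suffix l2 l1 : l = l1 ++ l2 ->
    run (fold_loop p) (on_work (code l2 ++ code (foldl step c l1) ++ s))
      (on_work (false :: code (foldl step c l) ++ s)) (size l2 * (n + 5) + 1).
  exact: (run_suffix l [::]).
elim: l2 l1 => [|b l2 IHl2] l1 l_eq.
  by rewrite l_eq cats0; apply: run_while_end.
apply: run_leq; last first.
  apply: run_while (IHl2 (rcons l1 b) _); rewrite ?cat_rcons //.
  apply: run_seq (run_push_work _ _) _.
  have := run_p _ _ _ l_eq; rewrite !cat_code_pair => run_step.
  exact: run_seq run_step (run_pop_work _ _).
by rewrite /= mulSn; lia.
Qed.

Lemma FP_foldl_bounded {A B C : encType} (f : A -> C -> B -> C) (z : A -> C)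
    (l : A -> seq B) (bound : A -> nat) :
  FP3 f -> FP z -> FP l -> poly_bounded code_size bound ->
  (forall a l1 l2, l a = l1 ++ l2 ->
     code_size (foldl (f a) (z a) l1) <= bound a) ->
  FP (fun a => foldl (f a) (z a) (l a)).
Proof.
move=> fp_f fp_z fp_l bound_poly le_bound.
pose step (x : A * C) b : A * C := (x.1, f x.1 x.2 b).
have foldl_step a l1 : foldl step (a, z a) l1 = (a, foldl (f a) (z a) l1).
  by elim/last_ind: l1 => // l1 b IHl1; rewrite !foldl_rcons IHl1.
pose next (x : seq B * (A * C)) :=
  if x.1 is b :: l' then (l', step x.2 b) else x.
have [p [t [[k le_t] run_p]]] : FP next.
  apply: (FP_list_case (g := fun x b l' => (l', step x.2 b)));
    by rewrite /step; fp.
have size_l := FP_code_size fp_l.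
have [q [u [bound_u run_q]]] : FP (fun a => (l a, (a, z a))) by fp.
pose n a := (code_size (l a) + code_size a + bound a + 4) ^ k.
suff : FP (fun a => (a, foldl (f a) (z a) (l a))) by apply: FP_comp FP_snd.
exists (q ;; Pop Work ;; fold_loop p ;; Pop Work).
exists (fun a => u a + (1 + (code_size (l a) * (n a + 5) + 1 + 1))).
split=> [|a s]; first by rewrite /n; poly_bound.
have run_init := run_q a s; rewrite cat_code_pair in run_init.
apply: run_seq run_init _; apply: run_seq (run_pop_work _ _) _.
apply: run_seq _ (run_pop_work false _).
apply: (@run_leq (size (l a) * (n a + 5) + 1)).
  by rewrite leq_add2r leq_mul2r ltnW ?orbT ?size_lt_code_size.
rewrite -foldl_step; apply: run_fold_loop => l1 b l2 l_eq.
rewrite !foldl_step; have := run_p (b :: l2, (a, foldl (f a) (z a) l1)) s.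
rewrite foldl_rcons; apply: run_leq; apply: leq_trans (le_t _) _.
have := le_bound _ _ _ l_eq; have := code_size_cat l1 (b :: l2).
have := code_size_gt0 l1; rewrite /n -l_eq !code_size_pair => *.
by case: (k) => // j; rewrite leq_exp2r //; lia.
Qed.

Definition read_input : prog :=
  transfer Input Scratch ;; Push Work false ;;
  drain Scratch (fun b => push_word (true :: code b)).

Lemma run_read_input (x : bits) :
  run read_input (Store x [::] [::] [::]) (on_work (code x)) (20 * size x + 4).
Proof.
have run_reverse : run (transfer Input Scratch) (Store x [::] [::] [::])
    (Store [::] [::] (rev x) [::]) (7 * size x).+1.
  exact: (@run_transfer Input Scratch (Store _ [::] [::] [::])).
have run_encode : run (drain Scratch (fun b => push_word (true :: code b)))
    (Store [::] [:: false] (rev x) [::]) (on_work (code x)) (13 * size x).+1.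
  have := @run_drain Scratch (fun b => push_word (true :: code b)) 8
    (fun done w => Store [::] (code done) w [::]) (fun _ _ => erefl) _
    (rev x) [::].
  rewrite catrevE revK cats0 size_rev; apply => done b w.
  by apply: run_leq (run_push_word (true :: code b) _ _ _ _); case: b.
have run_nil := run_push Work false (Store [::] [::] (rev x) [::]).
by apply: run_leq (run_seq run_reverse (run_seq run_nil run_encode)); lia.
Qed.

Definition pop_bits : prog :=
  While Work is_one (Pop Work ;;
    If Work is_one (Pop Work ;; Pop Work ;; Pop Work ;; Push Scratch true)
      (Pop Work ;; Push Scratch false)).

Lemma run_pop_bits (y done : bits) :
  run pop_bits (Store [::] (code y) done [::])
    (Store [::] [:: false] (catrev y done) [::]) (10 * size y + 1).
Proof.
elim: y done => [|b y IHy] done; first exact: run_while_end.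
apply: run_leq; last first.
  apply: run_while (IHy (b :: done)) => //; apply: run_seq (run_pop _ _) _.
  apply: (run_if (n := 1 + (1 + (1 + 2)))); case: b => /=.
    do 3!apply: run_seq (run_pop _ _) _; exact: run_push.
  apply: (@run_leq (1 + 2)) => //.
  exact: run_seq (run_pop _ _) (run_push _ _ _).
by rewrite /=; lia.
Qed.

Definition write_output : prog := pop_bits ;; transfer Scratch Output.

Lemma run_write_output (y : bits) :
  run write_output (on_work (code y)) (Store [::] [:: false] [::] y)
    (20 * size y + 4).
Proof.
have run_reverse : run (transfer Scratch Output)
    (Store [::] [:: false] (rev y) [::]) (Store [::] [:: false] [::] y)
    (7 * size y).+1.
  have := @run_transfer Scratch Output (Store [::] [:: false] (rev y) [::]).
  by rewrite /= catrevE revK cats0 size_rev; apply.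
by apply: run_leq (run_seq (run_pop_bits y [::]) run_reverse); lia.
Qed.

Lemma code_size_bits (x : bits) : code_size x <= 4 * size x + 1.
Proof.
elim: x => //= b x IHx; rewrite code_size_cons.
have : code_size b <= 3 by case: b.
by lia.
Qed.

Lemma polytime_FP (f : bits -> bits) : FP f -> polytime f.
Proof.
move=> fp_f; have size_f := FP_code_size fp_f.
case: fp_f => p [g [bound_g run_p]]; apply/polytimeP.
exists (instr_machine (compile (read_input ;; p ;; write_output) 0)).
exists (fun x => 20 * size x + 4 + (g x + (20 * code_size (f x) + 4))).
have code_size_poly : poly_bounded size (fun x : bits => code_size x).
  by apply: poly_bounded_leq code_size_bits _; poly_bound.
have := poly_bounded_comp bound_g code_size_poly.
have := poly_bounded_comp size_f code_size_poly => bound_f bound_time.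
split=> [|x]; first by poly_bound.
have run_x := run_p x [::]; rewrite !cats0 in run_x.
have run_y := run_write_output (f x).
apply: (run_computes_within (m := Store [::] [:: false] [::] (f x))) => //.
apply: run_leq (run_seq (run_read_input x) (run_seq run_x run_y)).
by rewrite !leq_add2l leq_add2r leq_mul2l ltnW ?size_lt_code_size ?orbT.
Qed.

(** * Closure properties *)

Lemma FP_foldl {A B C : encType} (f : A -> C -> B -> C) (z : A -> C)
    (l : A -> seq B) (growth : A * B -> nat) :
  FP3 f -> FP z -> FP l -> poly_bounded code_size growth ->
  (forall a c b, code_size (f a c b) <= code_size c + growth (a, b)) ->
  FP (fun a => foldl (f a) (z a) (l a)).
Proof.
move=> fp_f fp_z fp_l [k le_growth] le_f.
pose n a := (code_size a + code_size (l a) + 3) ^ k.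
have size_z := FP_code_size fp_z; have size_l := FP_code_size fp_l.
apply: (FP_foldl_bounded
  (bound := fun a => code_size (z a) + code_size (l a) * n a)) => //.
  by rewrite /n; poly_bound.
move=> a l1 l2 l_eq.
have growth_n l3 b l4 : l a = l3 ++ b :: l4 -> growth (a, b) <= n a.
  move=> l_eq'; apply: leq_trans (le_growth _) _; rewrite code_size_pair /n.
  have := code_size_cat l3 (b :: l4); have := code_size_gt0 l3.
  rewrite l_eq' code_size_cons => *.
  by case: (k) => // j; rewrite leq_exp2r //; lia.
apply: (@leq_trans (code_size (z a) + size l1 * n a)).
  elim/last_ind: l1 l2 l_eq => [|l1 b IHl1] l2 l_eq; first by rewrite addn0.
  rewrite foldl_rcons size_rcons mulSn; apply: leq_trans (le_f _ _ _) _.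
  rewrite cat_rcons in l_eq.
  by have := IHl1 _ l_eq; have := growth_n _ _ _ l_eq; lia.
rewrite leq_add2l leq_mul2r; apply/orP; right; apply: ltnW.
by apply: leq_trans (size_lt_code_size _); rewrite l_eq size_cat leq_addr.
Qed.

Lemma FP_foldl_const {A B : encType} (f : B -> A -> B) (z : B) n :
  FP2 f -> (forall b a, code_size (f b a) <= code_size b + n) ->
  FP (foldl f z).
Proof.
move=> fp_f le_f; apply: (FP_foldl (f := fun=> f) (growth := fun=> n)).
- by fp.
- exact: FP_const.
- exact: FP_id.
- exact: poly_bounded_const.
- by move=> _.
Qed.

Definition unary (n : nat) : seq unit := nseq n tt.

Lemma code_unary n : code (unary n) = code n.
Proof. by rewrite /code; congr tree_code; elim: n => //= n ->. Qed.

Lemma FP_unary : FP unary.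
Proof. by apply: FP_ext FP_id => n; rewrite code_unary. Qed.

Lemma FP_of_unary {A : encType} (f : A -> nat) :
  FP (fun a => unary (f a)) -> FP f.
Proof. by apply: FP_ext => a; rewrite code_unary. Qed.

#[global] Hint Resolve FP_unary : fp.

Lemma FP_if {A B : encType} (c : A -> bool) (f g : A -> B) :
  FP c -> FP f -> FP g -> FP (fun a => if c a then f a else g a).
Proof.
move=> fp_c fp_f fp_g.
have fp_l : FP (fun a => unary (c a)).
  by apply: FP_ext fp_c => a; case: (c a).
have fp_f3 : FP3 (fun a (_ : unit) (_ : seq unit) => f a).
  by apply: (FP_comp fp_f); fp.
by apply: FP_ext (FP_list_case fp_l fp_g fp_f3) => a; case: (c a).
Qed.

Ltac fp_combinator ::= apply: FP_if.

Lemma FP_negb : FP negb.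
Proof. by rewrite /negb; fp. Qed.

Lemma FP_andb : FP2 andb.
Proof. by rewrite /andb; fp. Qed.

Lemma FP_orb : FP2 orb.
Proof. by rewrite /orb; fp. Qed.

Lemma FP_implb : FP2 implb.
Proof. by rewrite /implb; fp. Qed.

Lemma FP_nat_of_bool : FP nat_of_bool.
Proof. by rewrite /nat_of_bool; fp. Qed.

Lemma FP_behead {A : encType} : FP (@behead A).
Proof.
exact: (FP_list_case (g := fun _ _ l => l) FP_id (FP_const [::]) FP_snd).
Qed.

Lemma FP_head {A : encType} (x : A) : FP (head x).
Proof.
by apply: (FP_list_case (g := fun _ y _ => y) FP_id (FP_const x)); fp.
Qed.

#[global] Hint Resolve FP_negb FP_andb FP_orb FP_implb FP_nat_of_bool : fp.
#[global] Hint Resolve FP_behead FP_head : fp.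

Lemma FP_succn : FP succn.
Proof.
apply: FP_of_unary.
by apply: (FP_ext (f := fun n => tt :: unary n)) => //; fp.
Qed.

Lemma FP_predn : FP predn.
Proof.
apply: FP_of_unary.
by apply: (FP_ext (f := fun n => behead (unary n))) => [[]|]; fp.
Qed.

#[global] Hint Resolve FP_succn FP_predn : fp.

Lemma FP_catrev {A : encType} : FP2 (@catrev A).
Proof.
have fp_foldl : FP (fun p : seq A * seq A =>
    foldl (fun l x => x :: l) p.2 p.1).
  apply: (FP_foldl (f := fun _ l x => x :: l)
    (growth := fun q => 1 + code_size q.2)); try by fp.
    exact: poly_boundedD (poly_bounded_const _ 1) (FP_code_size FP_snd).
  by move=> p l x; rewrite code_size_cons addnA addn1 addnC.
apply: FP_ext fp_foldl => -[l1 l2] /=; congr code.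
by elim: l1 l2 => //= x l1 IHl1 l2; rewrite IHl1.
Qed.

Lemma FP_rev {A : encType} : FP (@rev A).
Proof. exact: (FP2_comp FP_catrev FP_id (FP_const [::])). Qed.

#[global] Hint Resolve FP_catrev FP_rev : fp.

Lemma FP_cat {A : encType} : FP2 (@cat A).
Proof.
have fp_catrev : FP (fun p : seq A * seq A => catrev (rev p.1) p.2) by fp.
by apply: FP_ext fp_catrev => p; rewrite catrevE revK.
Qed.

#[global] Hint Resolve FP_cat : fp.

Lemma FP_foldr {A B C : encType} (f : A -> B -> C -> C) (z : A -> C)
    (l : A -> seq B) (growth : A * B -> nat) :
  FP3 f -> FP z -> FP l -> poly_bounded code_size growth ->
  (forall a b c, code_size (f a b c) <= code_size c + growth (a, b)) ->
  FP (fun a => foldr (f a) (z a) (l a)).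
Proof.
move=> fp_f fp_z fp_l bound_growth le_f.
have fp_flip : FP3 (fun a c b => f a b c) by fp.
have fp_rev : FP (fun a => rev (l a)) by fp.
apply: FP_ext (FP_foldl fp_flip fp_z fp_rev bound_growth _) => [a|a c b].
  by rewrite foldl_rev.
exact: le_f.
Qed.

Lemma FP_flatten {A : encType} : FP (@flatten A).
Proof.
rewrite /flatten; apply: (FP_foldr (f := fun _ => cat)
  (growth := fun q => code_size q.2)); try by fp.
  exact: FP_code_size FP_snd.
by move=> l k c /=; have := code_size_cat k c; lia.
Qed.

Lemma FP_map {A B C : encType} (h : A -> B -> C) (l : A -> seq B) :
  FP2 h -> FP l -> FP (fun a => [seq h a b | b <- l a]).
Proof.
move=> fp_h fp_l.
apply: (FP_ext (f := fun a => foldr (fun b c => h a b :: c) [::] (l a))).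
  by move=> a; congr code; elim: (l a) => //= b k ->.
apply: (FP_foldr (f := fun a b c => h a b :: c)
  (growth := fun q => 1 + code_size (h q.1 q.2))); try by fp.
  exact: poly_boundedD (poly_bounded_const _ 1) (FP_code_size fp_h).
by move=> a b c; rewrite code_size_cons addnA addn1 addnC.
Qed.

Lemma code_size_nat (n : nat) : code_size n = n.*2.+1.
Proof.
rewrite /code_size -code_unary -/(code_size _).
by elim: n => //= n IHn; rewrite code_size_cons IHn doubleS.
Qed.

Lemma FP_count {A B : encType} (h : A -> B -> bool) (l : A -> seq B) :
  FP2 h -> FP l -> FP (fun a => count (h a) (l a)).
Proof.
move=> fp_h fp_l.
apply: (FP_ext
  (f := fun a => foldr (fun b n => if h a b then n.+1 else n) 0 (l a))).
  by move=> a; congr code; elim: (l a) => //= b k ->; case: (h a b).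
apply: (FP_foldr (f := fun a b n => if h a b then n.+1 else n)
  (growth := fun=> 2)); try by fp.
  exact: poly_bounded_const.
by move=> a b n; case: ifP; rewrite !code_size_nat; lia.
Qed.

Lemma FP_size {A : encType} : FP (@size A).
Proof.
apply: FP_ext (FP_count (h := fun _ => predT) (FP_const true) FP_id) => l.
by rewrite count_predT.
Qed.

#[global] Hint Resolve FP_flatten FP_size : fp.

Lemma FP_has {A B : encType} (h : A -> B -> bool) (l : A -> seq B) :
  FP2 h -> FP l -> FP (fun a => has (h a) (l a)).
Proof.
move=> fp_h fp_l; have fp_count := FP_count fp_h fp_l.
have fp_nonempty : FP (fun l : seq unit => if l is _ :: _ then true else false).
  by apply: (FP_list_case (g := fun _ _ _ => true) FP_id (FP_const false)); fp.
apply: FP_ext (FP_comp fp_nonempty (FP_comp FP_unary fp_count)) => a.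
by rewrite has_count; case: (count _ _).
Qed.

Lemma FP_all {A B : encType} (h : A -> B -> bool) (l : A -> seq B) :
  FP2 h -> FP l -> FP (fun a => all (h a) (l a)).
Proof.
move=> fp_h fp_l; have fp_neg : FP2 (fun a b => ~~ h a b) by fp.
apply: FP_ext (FP_comp FP_negb (FP_has fp_neg fp_l)) => a.
by rewrite -all_predC; congr code; apply: eq_all => b /=; rewrite negbK.
Qed.

Lemma FP_iter {A B : encType} (h : A -> B -> B) (n : A -> nat) (z : A -> B)
    (bound : A -> nat) :
  FP2 h -> FP n -> FP z -> poly_bounded code_size bound ->
  (forall a i, i <= n a -> code_size (iter i (h a) (z a)) <= bound a) ->
  FP (fun a => iter (n a) (h a) (z a)).
Proof.
move=> fp_h fp_n fp_z bound_poly le_bound.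
have foldl_iter a (l : seq unit) :
    foldl (fun c _ => h a c) (z a) l = iter (size l) (h a) (z a).
  by elim/last_ind: l => // l b IHl; rewrite foldl_rcons size_rcons IHl.
have fp_round : FP3 (fun a c (_ : unit) => h a c) by fp.
have fp_l : FP (fun a => unary (n a)) by fp.
apply: FP_ext (FP_foldl_bounded fp_round fp_z fp_l bound_poly _) => [a|a l1 l2].
  by rewrite foldl_iter size_nseq.
move/(congr1 size); rewrite size_nseq size_cat foldl_iter => n_eq.
by apply: le_bound; rewrite n_eq leq_addr.
Qed.

Lemma FP_drop {A : encType} : FP2 (@drop A).
Proof.
apply: (FP_ext (f := fun p => iter p.1 behead p.2)) => [[n l] /=|].
  by rewrite drop_behead.
apply: (FP_iter (h := fun=> behead)
  (bound := fun p => code_size p.2)); try by fp.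
  exact: FP_code_size FP_snd.
move=> [n l] /= i _; rewrite -drop_behead -[l in leqRHS](cat_take_drop i).
have := code_size_cat (take i l) (drop i l).
by have := code_size_gt0 (take i l); lia.
Qed.

#[global] Hint Resolve FP_drop : fp.

Lemma FP_nth {A : encType} (x : A) : FP2 (nth x).
Proof.
have fp_head : FP (fun p => head x (drop p.2 p.1)) by fp.
by apply: FP_ext fp_head => -[l n]; rewrite -nth0 nth_drop addn0.
Qed.

Lemma FP_addn : FP2 addn.
Proof.
apply: FP_of_unary.
have fp_cat : FP (fun p : nat * nat => unary p.1 ++ unary p.2) by fp.
by apply: FP_ext fp_cat => p; rewrite /unary nseqD.
Qed.

Lemma FP_subn : FP2 subn.
Proof.
apply: FP_of_unary.
have fp_drop : FP (fun p : nat * nat => drop p.2 (unary p.1)) by fp.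
by apply: FP_ext fp_drop => p; rewrite /unary drop_nseq.
Qed.

#[global] Hint Resolve FP_nth FP_addn FP_subn : fp.

Lemma FP_leq : FP2 leq.
Proof.
have fp_unary : FP (fun p : nat * nat => unary (p.1 - p.2)) by fp.
have fp_has := FP_has (h := fun _ => predT) (FP_const true) fp_unary.
apply: FP_ext (FP_comp FP_negb fp_has) => p.
by rewrite has_nseq andbT lt0n negbK.
Qed.

#[global] Hint Resolve FP_leq : fp.

Lemma FP_eqn : FP2 (@eq_op nat).
Proof.
have fp_leq : FP (fun p : nat * nat => (p.1 <= p.2) && (p.2 <= p.1)) by fp.
by apply: FP_ext fp_leq => p; rewrite -eqn_leq.
Qed.

Lemma FP_minn : FP2 minn.
Proof. by rewrite /minn; fp. Qed.

#[global] Hint Resolve FP_eqn FP_minn : fp.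

Lemma code_size_iota n : code_size (iota 0 n) <= n * (n.*2 + 3) + 1.
Proof.
suff bound m k : m + k <= n -> code_size (iota m k) <= k * (n.*2 + 3) + 1.
  exact: bound.
elim: k m => // k IHk m le_n; have := IHk m.+1.
by rewrite /= code_size_cons code_size_nat mulSn; lia.
Qed.

Lemma FP_iota0 : FP (iota 0).
Proof.
have iter_iota n : iter n (fun l => 0 :: map succn l) [::] = iota 0 n.
  elim: n => //= n ->; congr cons; rewrite -[1]addn1 addnC iotaDl.
  by apply: eq_map => i; rewrite add1n.
apply: (FP_ext (f := fun n => iter n (fun l => 0 :: map succn l) [::])).
  by move=> n; rewrite iter_iota.
apply: (FP_iter (h := fun _ l => 0 :: map succn l)
  (bound := fun n => code_size n * (2 * code_size n + 3) + 1)); try by fp.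
- apply: (FP2_comp FP_cons (FP_const 0)).
  by apply: (FP_map (h := fun=> succn)); fp.
- by poly_bound.
- move=> n i le_in; rewrite iter_iota; apply: leq_trans (code_size_iota i) _.
  by rewrite code_size_nat; nia.
Qed.

#[global] Hint Resolve FP_iota0 : fp.

Lemma FP_mkseq {A B : encType} (h : A -> nat -> B) (n : A -> nat) :
  FP2 h -> FP n -> FP (fun a => mkseq (h a) (n a)).
Proof. by move=> fp_h fp_n; apply: (FP_map fp_h); fp. Qed.

Ltac fp_combinator ::=
  lazymatch goal with
  | |- FP (fun x => map (@?h x) (@?l x)) => apply: (FP_map (h := h) (l := l))
  | |- FP (fun x => mkseq (@?h x) (@?n x)) =>
      apply: (FP_mkseq (h := h) (n := n))
  | |- FP (fun x => has (@?h x) (@?l x)) => apply: (FP_has (h := h) (l := l))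
  | |- FP (fun x => all (@?h x) (@?l x)) => apply: (FP_all (h := h) (l := l))
  | |- FP (fun x => count (@?h x) (@?l x)) =>
      apply: (FP_count (h := h) (l := l))
  | |- _ => apply: FP_if
  end.

(** * Words *)

(* The state records whether the next bit is a payload bit, the current word and
   the finished words; the last two are reversed. *)
Definition dec_step (s : bool * bits * seq bits) (b : bool) :
    bool * bits * seq bits :=
  if s.1.1 then (false, b :: s.1.2, s.2)
  else if b then (true, s.1.2, s.2) else (false, [::], s.1.2 :: s.2).

Definition dec_seq (x : bits) : seq bits :=
  rev [seq rev w | w <- (foldl dec_step (false, [::], [::]) x).2].

Lemma foldl_dec_step_word w rest cur done :
  foldl dec_step (false, cur, done) (enc_word w ++ rest) =
  foldl dec_step (false, [::], catrev w cur :: done) rest.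
Proof. by elim: w cur => [|b w IHw] cur //=; rewrite [LHS]IHw. Qed.

Lemma enc_seqK : cancel enc_seq dec_seq.
Proof.
move=> ws; rewrite /dec_seq.
suff -> done : foldl dec_step (false, [::], done) (enc_seq ws) =
    (false, [::], catrev (map rev ws) done).
  by rewrite catrevE cats0 map_rev revK mapK //; apply: revK.
elim: ws done => //= w ws IHws done.
by rewrite [enc_seq _]/(enc_word w ++ enc_seq ws) foldl_dec_step_word IHws.
Qed.

Lemma FP_dec_seq : FP dec_seq.
Proof.
have fp_foldl : FP (foldl dec_step (false, [::], [::])).
  apply: (FP_foldl_const _ (n := 20)); first by rewrite /dec_step; fp.
  move=> [[payload cur] done] b; rewrite /dec_step /=.
  by case: payload; case: b;
    rewrite !code_size_pair ?code_size_cons /code_size /=; lia.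
by rewrite /dec_seq; fp.
Qed.

Lemma size_enc_word w : size (enc_word w) = (size w).*2.+1.
Proof. by rewrite /enc_word size_cat addn1; elim: w => //= b w ->. Qed.

Lemma FP_enc_word : FP enc_word.
Proof. by rewrite /enc_word; fp. Qed.

#[global] Hint Resolve FP_dec_seq FP_enc_word : fp.

Lemma FP_enc_seq : FP enc_seq.
Proof. by rewrite /enc_seq; fp. Qed.

#[global] Hint Resolve FP_enc_seq : fp.

Definition bits_val (w : bits) : nat :=
  foldr (fun (b : bool) n => b + n.*2) 0 w.

Lemma bits_val_mkseq w n :
  size w <= n -> bits_val (mkseq (nth false w) n) = bits_val w.
Proof.
rewrite /mkseq; elim: n w => [|n IHn] w le_wn; first by case: w le_wn.
rewrite /= -[1]addn0 iotaDl -map_comp.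
rewrite (eq_map (g := nth false (behead w))); last first.
  by move=> i /=; rewrite nth_behead.
by rewrite IHn ?size_behead; [case: w {le_wn} | lia].
Qed.

(* Compares [c * den] with [num] by Horner's rule from the most significant
   bit: the state is 0 if the difference [num - c * den] of the prefixes is
   negative, as it then stays so, and [(minn c difference).+1] otherwise, since
   a difference of at least [c] can no longer become negative. *)
Definition horner_step (c acc : nat) (nd : bool * bool) : nat :=
  if 0 < acc then
    if (if nd.2 then c else 0) <= acc.-1 + acc.-1 + nd.1 then
      (minn c (acc.-1 + acc.-1 + nd.1 - (if nd.2 then c else 0))).+1
    else 0
  else 0.

Lemma horner_step_leq c acc nd : horner_step c acc nd <= c.+1.
Proof.
by rewrite /horner_step; do 2!case: ifP => // _; rewrite ltnS geq_minl.
Qed.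

Lemma foldr_horner_step c (l : seq (bool * bool)) :
  foldr (fun nd acc => horner_step c acc nd) 1 l =
    if c * bits_val (unzip2 l) <= bits_val (unzip1 l)
    then (minn c (bits_val (unzip1 l) - c * bits_val (unzip2 l))).+1 else 0.
Proof.
elim: l => [|[b d] l IHl]; first by rewrite /= muln0 subn0 minn0.
rewrite /= {}IHl -/(bits_val _) -/(bits_val _).
move: (bits_val (unzip1 l)) (bits_val (unzip2 l)) => num den.
have -> : c * (d + den.*2) = (if d then c else 0) + (c * den).*2.
  by case: d; lia.
rewrite /horner_step /=; move: (c * den) => cden.
by case: (leqP cden num) => /= ?; case: d => /=; case: b => /=;
  do ![case: leqP => /= ?]; lia.
Qed.

(* Pads the shorter word with zeros, unlike [zip]. *)
Definition zip_bits (v w : bits) : seq (bool * bool) :=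
  mkseq (fun i => (nth false v i, nth false w i)) (size v + size w).

Lemma bits_val_zip_bits v w :
  bits_val (unzip1 (zip_bits v w)) = bits_val v /\
  bits_val (unzip2 (zip_bits v w)) = bits_val w.
Proof.
rewrite /unzip1 /unzip2 -!map_comp.
by rewrite !bits_val_mkseq ?leq_addr ?leq_addl.
Qed.

Definition scaled_leq (c : nat) (den num : bits) : bool :=
  0 < foldl (horner_step c) 1 (rev (zip_bits num den)).

Lemma scaled_leqE c den num :
  scaled_leq c den num = (c * bits_val den <= bits_val num).
Proof.
have [num_eq den_eq] := bits_val_zip_bits num den.
by rewrite /scaled_leq foldl_rev foldr_horner_step num_eq den_eq; case: ifP.
Qed.

Lemma FP_scaled_leq : FP3 scaled_leq.
Proof.
have fp_zip : FP2 zip_bits by rewrite /zip_bits; fp.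
have fp_foldl : FP (fun x : nat * bits * bits =>
    foldl (horner_step x.1.1) 1 (rev (zip_bits x.2 x.1.2))).
  apply: (FP_foldl_bounded (f := fun x => horner_step x.1.1) (z := fun=> 1)
    (bound := fun x => code_size x.1.1 + 3)).
  - by rewrite /horner_step; fp.
  - exact: FP_const.
  - by fp.
  - apply: poly_boundedD (poly_bounded_const _ 3).
    by apply: (FP_code_size (f := fun x => x.1.1)); fp.
  - move=> x l _ _; rewrite !code_size_nat.
    elim/last_ind: l => [|l nd _]; first by rewrite /=; lia.
    rewrite foldl_rcons; set acc := foldl _ _ _.
    by have := horner_step_leq x.1.1 acc nd; lia.
by rewrite /scaled_leq; fp.
Qed.

(* The state is the carry and the reversed result. *)
Definition inc_step (s : bool * bits) (b : bool) : bool * bits :=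
  if s.1 then (if b then (true, false :: s.2) else (false, true :: s.2))
  else (false, b :: s.2).

Definition flush_carry (s : bool * bits) : bits :=
  rev (if s.1 then true :: s.2 else s.2).

Definition inc_word (w : bits) : bits :=
  flush_carry (foldl inc_step (true, [::]) w).

Lemma foldl_inc_step_no_carry w done :
  flush_carry (foldl inc_step (false, done) w) = catrev done w.
Proof. by elim: w done => //= b w IHw done; apply: IHw. Qed.

Lemma foldl_inc_step_carry p done :
  flush_carry (foldl inc_step (true, done) (enc_pos p)) =
  catrev done (enc_pos (PosDef.Pos.succ p)).
Proof.
elim: p done => [p IHp|p IHp|] done //=; first exact: IHp.
exact: foldl_inc_step_no_carry.
Qed.

Lemma inc_enc_nat n : inc_word (enc_nat n) = enc_nat n.+1.
Proof.
rewrite /inc_word /enc_nat.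
have -> : bin_of_nat n.+1 =
    Npos (if bin_of_nat n is Npos p then PosDef.Pos.succ p else xH).
  apply: (can_inj nat_of_binK); rewrite bin_of_natK -{1}(bin_of_natK n).
  by case: (bin_of_nat n) => //= p; rewrite nat_of_succ_pos.
by case: (bin_of_nat n) => //= p; rewrite foldl_inc_step_carry.
Qed.

Lemma iter_inc_word n : iter n inc_word [::] = enc_nat n.
Proof. by elim: n => // n IHn; rewrite iterS IHn inc_enc_nat. Qed.

Lemma bits_val_enc_nat n : bits_val (enc_nat n) = n.
Proof.
have val_pos p : bits_val (enc_pos p) = nat_of_pos p.
  by elim: p => [p IHp|p IHp|] //=; rewrite -/(bits_val _) IHp NatTrec.doubleE.
by rewrite /enc_nat -{2}(bin_of_natK n); case: (bin_of_nat n) => //= p.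
Qed.

Lemma size_enc_nat n : size (enc_nat n) <= n.
Proof.
elim: n => // n IHn; rewrite -inc_enc_nat /inc_word /flush_carry size_rev.
have size_inc w s : size (foldl inc_step s w).2 = size w + size s.2.
  elim: w s => //= b w IHw [[] done]; rewrite IHw /inc_step;
    by case: b => /=; lia.
by case: ifP => _ /=; rewrite size_inc /=; lia.
Qed.

Lemma FP_inc_word : FP inc_word.
Proof.
have fp_foldl : FP (foldl inc_step (true, [::])).
  apply: (FP_foldl_const _ (n := 20)); first by rewrite /inc_step; fp.
  move=> [carry done] b; rewrite /inc_step /=.
  by case: carry; case: b;
    rewrite !code_size_pair code_size_cons /code_size /=; lia.
by rewrite /inc_word /flush_carry; fp.
Qed.

Lemma FP_enc_nat : FP enc_nat.
Proof.
apply: (FP_ext (f := fun n => iter n inc_word [::])) => [n|].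
  by rewrite iter_inc_word.
apply: (FP_iter (h := fun=> inc_word) (z := fun=> [::])
  (bound := fun n => 4 * code_size n + 1)).
- exact: FP_comp FP_inc_word FP_snd.
- exact: FP_id.
- exact: FP_const.
- by poly_bound.
- move=> n i le_in; rewrite iter_inc_word.
  apply: leq_trans (code_size_bits _) _.
  by have := size_enc_nat i; rewrite code_size_nat; lia.
Qed.

#[global] Hint Resolve FP_scaled_leq FP_enc_nat : fp.

(** * Connectivity of encoded graphs *)

Definition entry (M : seq bits) (i j : nat) : bool :=
  nth false (nth [::] M i) j.

Lemma FP_entry : FP3 entry.
Proof. by rewrite /entry; fp. Qed.

#[global] Hint Resolve FP_entry : fp.

(* A round of breadth-first search inside [C], from the set [R]. *)
Definition expand (M : seq bits) (C R : bits) : bits :=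
  mkseq (fun j => nth false C j && (nth false R j ||
           has (fun i => nth false R i && (entry M i j || entry M j i))
               (iota 0 (size M))))
        (size M).

Definition search (M : seq bits) (C : bits) (r k : nat) : bits :=
  iter k (expand M C) (mkseq (fun j => j == r) (size M)).

Definition reach (M : seq bits) (C : bits) (r : nat) : bits :=
  search M C r (size M).

Definition connected_word (M : seq bits) (C : bits) : bool :=
  has (fun r => nth false C r &&
         all (fun j => nth false C j ==> nth false (reach M C r) j)
             (iota 0 (size M)))
      (iota 0 (size M)).

Lemma size_search M C r k : size (search M C r k) = size M.
Proof. by case: k => [|k]; rewrite size_mkseq. Qed.

Lemma FP_reach : FP3 reach.
Proof.
have fp_expand : FP3 expand by rewrite /expand; fp.
rewrite /FP3 /reach /search.
have fp_init : FP (fun x : seq bits * bits * nat =>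
  mkseq (fun j => j == x.2) (size x.1.1)) by fp.
have fp_round : FP2 (fun (x : seq bits * bits * nat) => expand x.1.1 x.1.2).
  by apply: (FP3_comp fp_expand); fp.
apply: (FP_iter (bound := fun x => 4 * code_size x + 1) fp_round _ fp_init).
- by fp.
- by poly_bound.
- move=> [[M C] r] k _; apply: leq_trans (code_size_bits _) _.
  rewrite -/(search M C r k) size_search leq_add2r leq_mul2l /=.
  apply: leq_trans (ltnW (size_lt_code_size M)) _.
  by rewrite !code_size_pair; lia.
Qed.

#[global] Hint Resolve FP_reach : fp.

Lemma FP_connected_word : FP2 connected_word.
Proof. by rewrite /connected_word; fp. Qed.

#[global] Hint Resolve FP_connected_word : fp.

Lemma nth_enc_set n (C : {set 'I_n}) (i : 'I_n) :
  nth false (enc_set C) i = (i \in C).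
Proof. by rewrite (nth_map i) ?size_enum_ord // nth_ord_enum. Qed.

Lemma has_iota_ord n (P : pred nat) :
  reflect (exists i : 'I_n, P i) (has P (iota 0 n)).
Proof.
apply: (iffP hasP) => [[i]|[i Pi]].
  by rewrite mem_iota => lt_in Pi; exists (Ordinal lt_in).
by exists (val i) => //; rewrite mem_iota ltn_ord.
Qed.

Lemma all_iota_ord n (P : pred nat) :
  reflect (forall i : 'I_n, P i) (all P (iota 0 n)).
Proof.
apply: (iffP allP) => [Pn i|Pn i]; first by apply: Pn; rewrite mem_iota ltn_ord.
by rewrite mem_iota => lt_in; apply: (Pn (Ordinal lt_in)).
Qed.

Lemma adjC (T : finType) (E : {set {set T}}) x y : adj E x y = adj E y x.
Proof. by rewrite /adj setUC. Qed.

Lemma induced_adj_sym (T : finType) (E : {set {set T}}) C :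
  connect_sym (induced_adj E C).
Proof.
by apply: sym_connect_sym => x y; rewrite /induced_adj adjC andbCA.
Qed.

Lemma induced_connectedP (T : finType) (E : {set {set T}}) (C : {set T}) :
  induced_connected E C <->
  exists2 r, r \in C & {in C, forall x, connect (induced_adj E C) r x}.
Proof.
split=> [[/set0Pn [r rC] conn]|[r rC conn]].
  by exists r => // x xC; apply: conn.
split=> [|x y xC yC]; first by apply/set0Pn; exists r.
by apply: (connect_trans (y := r)) (conn y yC); rewrite induced_adj_sym conn.
Qed.

Section Search.

Variables (n : nat) (E : {set {set 'I_n}}) (C : {set 'I_n}) (M : seq bits).
Hypothesis size_M : size M = n.
Hypothesis adj_M : forall i j : 'I_n, adj E i j = entry M i j || entry M j i.

Local Notation reached r k j := (nth false (search M (enc_set C) r k) j).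

Lemma nth_searchS (r : 'I_n) k (j : 'I_n) :
  reached r k.+1 j =
    (j \in C) &&
    (reached r k j || [exists i : 'I_n, reached r k i && adj E i j]).
Proof.
rewrite {1}/search iterS -/(search _ _ _ _) nth_mkseq ?size_M // nth_enc_set.
congr (_ && (_ || _)); apply/has_iota_ord/existsP => -[i /andP[reach_i adj_ij]];
  by exists i; rewrite reach_i; move: adj_ij; rewrite adj_M.
Qed.

Lemma searchP (r : 'I_n) k (j : 'I_n) : r \in C ->
  reflect
    (exists p, [/\ path (induced_adj E C) r p, size p <= k & last r p = j])
    (reached r k j).
Proof.
move=> rC; elim: k j => [|k IHk] j.
  rewrite nth_mkseq ?size_M //; apply: (iffP eqP) => [/val_inj ->|].
    by exists [::].
  by case=> [[|x p]] [_ le_p0 last_p] //; rewrite -last_p.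
rewrite nth_searchS; apply: (iffP andP) => [[jC]|[]].
  case/orP=> [/IHk[p [rp le_pk last_p]]|/existsP[i /andP[/IHk reach_i adj_ij]]].
    by exists p; split=> //; apply: leqW.
  have [p [rp le_pk last_p]] := reach_i; exists (rcons p j).
  rewrite last_rcons size_rcons rcons_path rp last_p; split=> //.
  rewrite /induced_adj jC adj_ij !andbT -last_p.
  case/lastP: p rp {le_pk last_p} => // p i'.
  by rewrite rcons_path last_rcons => /andP[_ /and3P[]].
case/lastP=> [[_ _ <-]|p j' [rp le_pk <-]].
  by split=> //; apply/orP; left; apply/IHk; exists [::].
rewrite last_rcons; move: rp le_pk; rewrite rcons_path size_rcons ltnS.
case/andP=> rp /and3P[_ j'C adj_j'] le_pk; split=> //; apply/orP; right.
by apply/existsP; exists (last r p); rewrite adj_j' andbT; apply/IHk; exists p.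
Qed.

Lemma connected_wordP :
  connected_word M (enc_set C) <-> induced_connected E C.
Proof.
rewrite induced_connectedP /connected_word /reach size_M; split.
  move/has_iota_ord=> [r /andP[]]; rewrite nth_enc_set => rC /all_iota_ord conn.
  exists r => // x xC; have := conn x; rewrite nth_enc_set xC /=.
  by case/(searchP _ _ rC) => p [rp _ <-]; apply/connectP; exists p.
move=> [r rC conn]; apply/has_iota_ord; exists r.
rewrite nth_enc_set rC; apply/all_iota_ord => j; rewrite nth_enc_set.
apply/implyP=> jC; apply/(searchP _ _ rC).
have /connectP[p rp ->] := conn j jC.
case/shortenP: rp => q rq uniq_q _; exists q; split=> //.
move/card_uniqP: uniq_q => /= size_q; have := max_card (mem (r :: q)).
by rewrite size_q card_ord => /ltnW.
Qed.

End Search.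

Definition rows n (a : rel 'I_n) : seq bits :=
  [seq [seq a i j | j <- enum 'I_n] | i <- enum 'I_n].

Lemma size_rows n (a : rel 'I_n) : size (rows a) = n.
Proof. by rewrite size_map size_enum_ord. Qed.

Lemma entry_rows n (a : rel 'I_n) (i j : 'I_n) : entry (rows a) i j = a i j.
Proof.
by rewrite /entry; do 2!rewrite (nth_map i) ?size_enum_ord // nth_ord_enum.
Qed.

Lemma size_enc_seq ws :
  size (enc_seq ws) = sumn [seq (size w).*2.+1 | w <- ws].
Proof.
rewrite /enc_seq size_flatten /shape -map_comp; congr sumn.
by apply: eq_map => w /=; rewrite size_enc_word.
Qed.

Lemma size_enc_rows n (a b : rel 'I_n) :
  size (enc_seq (rows a)) = size (enc_seq (rows b)).
Proof.
rewrite !size_enc_seq -!map_comp; congr sumn.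
by apply: eq_map => i /=; rewrite !size_map.
Qed.

Lemma mkseq_ord (T : Type) n (f : nat -> T) :
  mkseq f n = [seq f i | i : 'I_n <- enum 'I_n].
Proof. by rewrite /mkseq -val_enum_ord -map_comp. Qed.

Definition mask_matrix (G M : seq bits) : seq bits :=
  let n := size G in
  mkseq (fun i => mkseq (fun j => entry G i j && entry M i j) n) n.

Lemma FP_mask_matrix : FP2 mask_matrix.
Proof. by rewrite /mask_matrix; fp. Qed.

#[global] Hint Resolve FP_mask_matrix : fp.

Lemma mask_rows n (a : rel 'I_n) M :
  mask_matrix (rows a) M = rows (fun i j => a i j && entry M i j).
Proof.
rewrite /mask_matrix size_rows mkseq_ord; apply: eq_map => i /=.
by rewrite mkseq_ord; apply: eq_map => j /=; rewrite entry_rows.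
Qed.

Lemma count_rows n (a : rel 'I_n) :
  count id (flatten (rows a)) = #|[set p : 'I_n * 'I_n | a p.1 p.2]|.
Proof.
rewrite count_flatten -map_comp sumnE big_map big_enum /=.
under eq_bigr => i _ do rewrite /= count_map -sumn_count sumnE big_map big_enum.
rewrite pair_big /= -sum1_card [RHS]big_mkcond /=.
by apply: eq_bigr => p _; rewrite inE; case: (a _ _).
Qed.

Definition arc_edges (T : finType) (A : {set T * T}) : {set {set T}} :=
  [set [set p.1; p.2] | p in A].

Lemma eq_set2 (T : finType) (x y u v : T) :
  [set x; y] = [set u; v] -> (x = u /\ y = v) \/ (x = v /\ y = u).
Proof.
move=> eq_xy; have /set2P x_uv : x \in [set u; v] by rewrite -eq_xy set21.
have /set2P y_uv : y \in [set u; v] by rewrite -eq_xy set22.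
have /set2P u_xy : u \in [set x; y] by rewrite eq_xy set21.
have /set2P v_xy : v \in [set x; y] by rewrite eq_xy set22.
by intuition congruence.
Qed.

Lemma adj_arc_edges (T : finType) (A : {set T * T}) x y :
  adj (arc_edges A) x y = ((x, y) \in A) || ((y, x) \in A).
Proof.
apply/imsetP/orP => [[[u v] /= uvA]|[xyA|yxA]].
- by case/eq_set2=> -[-> ->]; [left | right].
- by exists (x, y).
- by exists (y, x); rewrite // setUC.
Qed.

Lemma connected_rowsP n (a : rel 'I_n) (C : {set 'I_n}) :
  connected_word (rows a) (enc_set C) <->
  induced_connected (arc_edges [set p | a p.1 p.2]) C.
Proof.
apply: connected_wordP => [|i j]; first exact: size_rows.
by rewrite adj_arc_edges !inE !entry_rows.
Qed.

Section Orientation.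

Variables (n : nat) (E : {set {set 'I_n}}).
Hypothesis card_edgeE : forall e, e \in E -> #|e| = 2.

Definition oriented : {set 'I_n * 'I_n} :=
  [set p : 'I_n * 'I_n | (p.1 < p.2) && adj E p.1 p.2].

Lemma arc_edges_oriented : arc_edges oriented = E.
Proof.
apply/setP=> e; apply/imsetP/idP => [[p]|eE].
  by rewrite inE => /andP[_ adj_p] ->.
have /eqP/cards2P[i [j [neq_ij e_eq]]] := card_edgeE eE.
have [lt_ij|lt_ji|/val_inj eq_ij] := ltngtP i j.
- by exists (i, j); rewrite // inE /= lt_ij /adj -e_eq.
- by exists (j, i); rewrite /= 1?setUC // inE /= lt_ji /adj setUC -e_eq.
- by rewrite eq_ij eqxx in neq_ij.
Qed.

Lemma card_oriented : #|oriented| = #|E|.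
Proof.
rewrite -[in RHS]arc_edges_oriented card_in_imset // => -[i j] [u v].
rewrite !inE /= => /andP[lt_ij _] /andP[lt_uv _] /eq_set2[[-> ->]//|[iv ju]].
by move: lt_ij; rewrite iv ju ltnNge ltnW.
Qed.

End Orientation.

(** * Membership in NP *)

Definition edge_count (M : seq bits) : nat := count id (flatten M).

Definition nws_check (M Cs : seq bits) (l : bits) (b : seq bits) : bool :=
  [&& ~~ head true l, scaled_leq (edge_count M) [:: true] (behead l),
      scaled_leq (edge_count M) (behead (nth [::] b 1))
        (behead (nth [::] b 0)) &
      all (connected_word M) Cs].

Definition instance_field (x : bits) (i : nat) : bits :=
  nth [::] (dec_seq (nth [::] (dec_seq x) 0)) i.

Definition chosen_matrix (x : bits) : seq bits :=
  mask_matrix (dec_seq (instance_field x 0)) (dec_seq (nth [::] (dec_seq x) 1)).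

Definition nws_verifier (x : bits) : bits :=
  [:: nws_check (chosen_matrix x) (dec_seq (instance_field x 1))
        (instance_field x 2) (dec_seq (instance_field x 3))].

Lemma FP_nws_verifier : FP nws_verifier.
Proof.
have fp_field : FP2 instance_field by rewrite /instance_field; fp.
have fp_count : FP edge_count.
  by apply: (FP_ext (f := fun M => count (fun b => b) (flatten M))) => //; fp.
have fp_matrix : FP chosen_matrix by rewrite /chosen_matrix; fp.
by rewrite /nws_verifier /nws_check; fp.
Qed.

Lemma enc_int_geq (c : nat) (l : int) :
  ~~ head true (enc_int l) && scaled_leq c [:: true] (behead (enc_int l)) =
  (c%:Z <= l)%R.
Proof.
rewrite scaled_leqE /= bits_val_enc_nat muln1 -leNgt.
by case: l => [n|n]; rewrite /= ?lez_nat //; lia.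
Qed.

Lemma enc_rat_geq (c : nat) (b : rat) : (0 < b)%R ->
  scaled_leq c (behead (enc_int (denq b))) (behead (enc_int (numq b))) =
  (c%:R <= b)%R.
Proof.
move=> b_gt0; rewrite scaled_leqE /= !bits_val_enc_nat.
rewrite -[in RHS](divq_num_den b) ler_pdivlMr ?ltr0z ?denq_gt0 //.
have num_gt0 : (0 < numq b)%R by rewrite numq_gt0.
have := denq_gt0 b; rewrite -[(c%:R)%R]/((c%:Z)%:~R)%R -intrM ler_int.
by move: (denq b) (numq b) num_gt0 => d m; lia.
Qed.

Definition nws_arcs (I : unweighted_nws_instance)
    (A : {set vertex (nws_graph I) * vertex (nws_graph I)}) : Prop :=
  [/\ (#|A|%:Z <= edge_bound I)%R, (#|A|%:R <= budget I)%R &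
      forall C, C \in communities I -> induced_connected (arc_edges A) C].

Lemma nws_verifierP (I : unweighted_nws_instance) (u : bits) :
  (0 < budget I)%R ->
  nws_verifier (enc_seq [:: enc_unweighted_nws I; u]) = [:: true] <->
  nws_arcs [set p : vertex (nws_graph I) * vertex (nws_graph I) |
    adj (edges (nws_graph I)) p.1 p.2 && entry (dec_seq u) p.1 p.2].
Proof.
move=> b_gt0; set G := nws_graph I.
pose a : rel (vertex G) :=
  fun i j => adj (edges G) i j && entry (dec_seq u) i j.
rewrite /nws_verifier /chosen_matrix /instance_field !enc_seqK /=.
rewrite -/(rows (adj (edges G))) mask_rows -/a.
rewrite /nws_check /edge_count count_rows /= andbA enc_int_geq enc_rat_geq //.
have connP C := connected_rowsP a C.
split=> [[/and3P[le_l le_b /allP conn]]|[le_l le_b conn]].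
  by split=> // C C_in; apply/connP; apply: conn; apply: map_f.
congr [:: _]; rewrite le_l le_b; apply/allP => _ /mapP[C C_in ->].
by apply/connP; apply: conn.
Qed.

Lemma solution_of_arcs (I : unweighted_nws_instance)
    (A : {set vertex (nws_graph I) * vertex (nws_graph I)}) :
  {in A, forall p, adj (edges (nws_graph I)) p.1 p.2} -> nws_arcs A ->
  connectivity_nws_solution (communities I) (fun _ => 1%R : rat) (edge_bound I)
    (budget I) (arc_edges A).
Proof.
move=> adj_A [le_l le_b conn].
have le_card : #|arc_edges A| <= #|A| by apply: leq_imset_card.
split=> //.
- by apply/subsetP => e /imsetP[p /adj_A adj_p ->].
- by apply: le_trans le_l; rewrite lez_nat.
- by apply: le_trans le_b; rewrite sumr_const ler_nat.
Qed.

Lemma arcs_of_solution (I : unweighted_nws_instance)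
    (E' : {set {set vertex (nws_graph I)}}) :
  connectivity_nws_solution (communities I) (fun _ => 1%R : rat) (edge_bound I)
    (budget I) E' ->
  nws_arcs (oriented E').
Proof.
move=> [/subsetP sub_E le_l le_b conn].
have card_E' e : e \in E' -> #|e| = 2 by move/sub_E; apply: card_edge.
rewrite sumr_const in le_b.
by split; rewrite ?card_oriented ?arc_edges_oriented.
Qed.

Lemma nws_in_NP : in_NP unweighted_connectivity_nws.
Proof.
exists nws_verifier, 'X%R; split=> [|I b_gt0].
  exact: polytime_FP FP_nws_verifier.
rewrite hornerX /=; split=> [[E' sol]|[u [_ /(nws_verifierP _ b_gt0) arcs_u]]].
  pose certificate := rows (fun i j => (i, j) \in oriented E').
  exists (enc_seq certificate); split.
    rewrite (size_enc_rows _ (adj (edges (nws_graph I)))).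
    by rewrite /enc_unweighted_nws [leqRHS]size_enc_seq /= -/(enc_graph _); lia.
  apply/(nws_verifierP _ b_gt0); rewrite enc_seqK.
  have [/subsetP sub_E _ _ _] := sol.
  rewrite (_ : finset _ = oriented E'); first exact: arcs_of_solution.
  apply/setP=> -[i j]; rewrite !inE entry_rows inE /=.
  by apply: andb_idl => /andP[_ /sub_E].
eexists; apply: solution_of_arcs arcs_u => p.
by rewrite inE => /andP[].
Qed.

Lemma in_NP_restrict (P : problem) D : in_NP P -> in_NP (restrict (P := P) D).
Proof.
move=> [V [p [poly_V verify]]]; exists V, p; split=> // I [valid_I _].
exact: verify.
Qed.

(** * Hamiltonian cycles *)

Section Degrees.

Variables (T : finType) (E : {set {set T}}).
Hypothesis card_edgeE : forall e, e \in E -> #|e| = 2.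

Definition neighbours (x : T) : {set T} := [set y | adj E x y].

Lemma adj_neq x y : adj E x y -> x != y.
Proof.
by move/card_edgeE => card_xy; apply/eqP => eq_xy;
  move: card_xy; rewrite eq_xy setUid cards1.
Qed.

Lemma card_neighbours x : #|neighbours x| = #|[set e in E | x \in e]|.
Proof.
have inj_pair : injective (fun y => [set x; y]).
  by move=> y z /eq_set2[[]|[-> ->]].
rewrite -(card_imset _ inj_pair); congr #|pred_of_set _|; apply/setP=> e.
rewrite inE; apply/imsetP/andP => [[y]|[eE xe]].
  by rewrite inE => adj_xy ->; rewrite set21.
have /eqP/cards2P[u [v [_ e_eq]]] := card_edgeE eE.
move: xe; rewrite e_eq => /set2P[->|->].
  by exists v; rewrite // inE /adj -e_eq.
by exists u; rewrite 1?setUC // inE /adj setUC -e_eq.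
Qed.

Lemma handshake : \sum_x #|neighbours x| = 2 * #|E|.
Proof.
under eq_bigr => x _ do rewrite card_neighbours -sum1dep_card.
rewrite (exchange_big_dep (mem E)) /= => [|x e _ /andP[]//].
rewrite mulnC -sum_nat_const; apply: eq_bigr => e eE.
by rewrite -(card_edgeE eE) -sum1_card; apply: eq_bigl => x; rewrite eE.
Qed.

Lemma regular_of_leq_edges k :
  (forall x, k <= #|neighbours x|) -> 2 * #|E| <= k * #|T| ->
  forall x, #|neighbours x| = k.
Proof.
move=> min_degree le_edges x.
have degreeP y : true -> k <= #|neighbours y| ?= iff (k == #|neighbours y|).
  by move=> _; split.
have := leqif_sum degreeP; rewrite handshake sum_nat_const mulnC => -[le_sum].
by rewrite eqn_leq le_sum le_edges => /esym/forallP/(_ x)/eqP.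
Qed.

End Degrees.

Lemma exists_maximal_path (T : finType) (e : rel T) : T ->
  exists x p, [/\ path e x p, uniq (x :: p) & forall y, e y x -> y \in x :: p].
Proof.
move=> x0; pose is_length n := [exists t : n.-tuple T, uniq t && sorted e t].
have length1 : is_length 1 by apply/existsP; exists [tuple x0].
have length_le n : is_length n -> n <= #|T|.
  case/existsP=> t /andP[/card_uniqP card_t _].
  by rewrite -(size_tuple t) -card_t max_card.
case: (ex_maxnP (ex_intro is_length 1 length1) length_le) => n.
case/existsP=> t /andP[uniq_t path_t] max_n.
have size_t := size_tuple t.
move: path_t uniq_t size_t (max_n 1 length1); case: (tval t) => [|x p] /=.
  by move=> _ _ <-.
move=> path_p uniq_p size_p _; exists x, p; split=> // y e_yx.
apply: contraT => y_notin; suff /max_n : is_length n.+1 by rewrite ltnn.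
have size_yp : size (y :: x :: p) == n.+1 by rewrite /= -size_p.
by apply/existsP; exists (Tuple size_yp); rewrite /= y_notin e_yx path_p uniq_p.
Qed.

Lemma next_neq_prev (T : eqType) (s : seq T) x :
  uniq s -> 2 < size s -> x \in s -> next s x != prev s x.
Proof.
move=> uniq_s size_s x_in; apply/eqP => eq_next.
have : next s (next s x) = x by rewrite eq_next next_prev.
case: (rot_to x_in) => i p rot_s; rewrite -!(next_rot i uniq_s) rot_s.
move: uniq_s size_s; rewrite -(rot_uniq i) -(size_rot i) rot_s.
case: p {rot_s} => [|y [|z p]] //=; rewrite eqxx !inE !negb_or.
case/andP=> /and3P[x_y x_z _] _ _; rewrite eq_sym (negbTE x_y) eqxx => z_x.
by rewrite z_x eqxx in x_z.
Qed.

Section TwoRegular.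

Variables (T : finType) (E : {set {set T}}).
Hypothesis card_edgeE : forall e, e \in E -> #|e| = 2.
Hypothesis degree2 : forall x, #|neighbours E x| = 2.

Lemma neighbours_pair x y z :
  y != z -> adj E x y -> adj E x z -> neighbours E x = [set y; z].
Proof.
move=> neq_yz adj_y adj_z; apply/esym/eqP; rewrite eqEcard degree2 cards2.
by rewrite neq_yz subUset !sub1set !inE adj_y adj_z.
Qed.

Lemma exists_other_neighbour x y : exists2 z, adj E x z & z != y.
Proof.
have /eqP/cards2P[u [v [neq_uv nb_x]]] := degree2 x.
have adj_x z : (z \in [set u; v]) = adj E x z by rewrite -nb_x inE.
case: (eqVneq u y) => [u_y|u_neq_y].
  by exists v; rewrite -?adj_x ?set22 // -u_y eq_sym.
by exists u; rewrite // -adj_x set21.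
Qed.

(* The second neighbour [z] of [x] lies on the path; a successor of [z] would be
   its third neighbour, besides its predecessor and [x]. *)
Lemma ucycle_maximal_path x p :
  path (adj E) x p -> uniq (x :: p) ->
  (forall y, adj E y x -> y \in x :: p) ->
  ucycle (adj E) (x :: p) /\ 2 < size (x :: p).
Proof.
move=> path_p uniq_p maximal.
have nb_in_p y : adj E x y -> y \in p.
  move=> adj_xy; have := maximal y; rewrite adjC inE eq_sym.
  by rewrite (negbTE (adj_neq card_edgeE adj_xy)); apply.
case: p path_p uniq_p nb_in_p {maximal} => [|y q] /=.
  have [y adj_xy _] := exists_other_neighbour x x.
  by move=> _ _ /(_ y adj_xy).
case/andP=> adj_xy path_q uniq_q nb_in.
have [z adj_xz neq_zy] := exists_other_neighbour x y.
have := nb_in z adj_xz; rewrite inE (negbTE neq_zy) /= => z_in.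
case/splitPr: z_in path_q uniq_q {nb_in} => q1 [|w q2].
  rewrite cat_path /= => /and3P[path_q1 adj_z _] uniq_q; split; last first.
    by rewrite size_cat addnS.
  rewrite /ucycle /= rcons_path cat_path /= last_cat /= (adjC E z) adj_xz.
  by rewrite adj_xy path_q1 adj_z.
rewrite cat_path /= => /and4P[_ adj_az adj_zw _] uniq_q; exfalso.
have : uniq (x :: (y :: q1) ++ z :: w :: q2) by [].
rewrite -cat_cons cat_uniq => /and3P[/andP[x_notin _] disjoint _].
have w_notin : w \notin x :: y :: q1.
  by apply: (hasPn disjoint); rewrite !inE eqxx orbT.
set a := last y q1 in adj_az.
have a_in : a \in y :: q1 by apply: mem_last.
have neq_aw : a != w by apply: contraNneq w_notin => <-; rewrite inE a_in orbT.
have : x \in neighbours E z by rewrite inE adjC.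
rewrite (neighbours_pair neq_aw) //; last by rewrite adjC.
case/set2P=> x_eq; first by rewrite x_eq a_in in x_notin.
by rewrite x_eq mem_head in w_notin.
Qed.

Lemma adj_mem_ucycle s x y :
  ucycle (adj E) s -> 2 < size s -> x \in s -> adj E x y -> y \in s.
Proof.
move=> /andP[cycle_s uniq_s] size_s x_in adj_xy.
have adj_prev : adj E x (prev s x) by rewrite adjC (prev_cycle cycle_s).
have adj_next := next_cycle cycle_s x_in.
have : y \in neighbours E x by rewrite inE.
rewrite (neighbours_pair (next_neq_prev uniq_s size_s x_in) adj_next adj_prev).
by case/set2P=> ->; rewrite ?mem_next ?mem_prev.
Qed.

Lemma connected_two_regular_cycle : T -> (forall x y, connect (adj E) x y) ->
  exists s, [/\ 2 < size s, ucycle (adj E) s & forall x, x \in s].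
Proof.
move=> x0 conn.
have [x [p [path_p uniq_p maximal]]] := exists_maximal_path (adj E) x0.
have [cycle_p size_p] := ucycle_maximal_path path_p uniq_p maximal.
exists (x :: p); split=> // y.
have adj_sym : connect_sym (adj E) by apply: sym_connect_sym; apply: adjC.
have closed_p : closed (adj E) (mem (x :: p)).
  apply: intro_closed => // u v adj_uv u_in; exact: adj_mem_ucycle adj_uv.
by rewrite -[_ \in _](closed_connect closed_p (conn x y)) mem_head.
Qed.

End TwoRegular.

Lemma exists_third (T : finType) (x y : T) :
  2 < #|T| -> exists2 z, z != x & z != y.
Proof.
move=> card_T; have /subsetPn[z _] : ~~ ([set: T] \subset [set x; y]).
  apply/negP => /subset_leq_card; rewrite cardsT cards2.
  by case: (_ != _); lia.
by rewrite !inE negb_or => /andP[z_x z_y]; exists z.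
Qed.

Section VertexDeletion.

Variables (T : finType) (E : {set {set T}}).
Hypothesis card_T : 2 < #|T|.
Hypothesis card_edgeE : forall e, e \in E -> #|e| = 2.
Hypothesis deletion_connected : forall v, induced_connected E [set~ v].

Lemma exists_neighbour_avoiding x u : u != x -> exists2 y, adj E x y & y != u.
Proof.
move=> u_x; have [w w_x w_u] := exists_third x u card_T.
have [_ /(_ x w)] := deletion_connected u.
rewrite !inE eq_sym u_x w_u => /(_ isT isT)/connectP[[|y p] /=].
  by move=> _ w_eq; rewrite w_eq eqxx in w_x.
by rewrite /induced_adj !inE => /andP[/and3P[_ y_u adj_xy] _] _; exists y.
Qed.

Lemma card_neighbours_gt1 x : 1 < #|neighbours E x|.
Proof.
have [u u_x _] := exists_third x x card_T.
have [y adj_xy _] := exists_neighbour_avoiding u_x.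
have y_x : y != x by rewrite eq_sym (adj_neq card_edgeE).
have [z adj_xz z_y] := exists_neighbour_avoiding y_x.
by apply/card_gt1P; exists z, y; rewrite !inE.
Qed.

Lemma connect_adj x y : connect (adj E) x y.
Proof.
have [v v_x v_y] := exists_third x y card_T.
have [_ /(_ x y)] := deletion_connected v.
rewrite !inE ![_ == v]eq_sym v_x v_y => /(_ isT isT).
by apply: connect_sub => a b /and3P[_ _ adj_ab]; apply: connect1.
Qed.

Lemma cycle_of_deletions : #|E| <= #|T| ->
  exists s, [/\ 2 < size s, ucycle (adj E) s & forall x, x \in s].
Proof.
move=> le_edges; have /card_gt0P[x0 _] : 0 < #|T| by apply: leq_trans card_T.
have degree2 := regular_of_leq_edges card_edgeE card_neighbours_gt1.
apply: (connected_two_regular_cycle card_edgeE) => //; last exact: connect_adj.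
by apply: degree2; rewrite leq_mul2l.
Qed.

End VertexDeletion.

Section CycleEdges.

Variables (T : finType) (E : {set {set T}}) (s : seq T).
Hypothesis size_s : 2 < size s.
Hypothesis cycle_s : ucycle (adj E) s.
Hypothesis mem_s : forall x, x \in s.

Definition cycle_edges : {set {set T}} := [set [set x; next s x] | x : T].

Lemma cycle_edges_sub : cycle_edges \subset E.
Proof.
case/andP: cycle_s => adj_s _; apply/subsetP => _ /imsetP[x _ ->].
exact: next_cycle adj_s (mem_s x).
Qed.

Lemma cycle_edges_deletion v : induced_connected cycle_edges [set~ v].
Proof.
case/andP: cycle_s => _ uniq_s; have [i p rot_s] := rot_to (mem_s v).
have [y [q p_eq]] : exists y q, p = y :: q.
  move: size_s; rewrite -(size_rot i) rot_s.
  by case: p {rot_s} => // y q; exists y, q.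
have := uniq_s; rewrite -(rot_uniq i) rot_s p_eq => /andP[v_notin _].
have avoid_v z : z \in y :: q -> z \in [set~ v].
  by move=> z_in; rewrite !inE; apply: contraNneq v_notin => <-.
have path_q : path (induced_adj cycle_edges [set~ v]) y q.
  have := cycle_next uniq_s; rewrite -(rot_cycle i) rot_s p_eq /= rcons_path.
  case/and3P=> _ path_next _; apply: sub_in_path path_next; last first.
    by apply/allP=> z; exact: avoid_v.
  move=> a b a_in b_in /eqP next_a; apply/and3P; split=> //.
  by rewrite /adj -next_a; apply: imset_f.
apply/induced_connectedP; exists y; first by apply: avoid_v; apply: mem_head.
move=> x; rewrite !inE => x_v; apply: (path_connect path_q).
by have := mem_s x; rewrite -(mem_rot i) rot_s p_eq inE (negbTE x_v).
Qed.

End CycleEdges.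

(** * The reduction *)

(* The empty community is never connected; as it joins no vertices, there are as
   many components as vertices, and the bound 1 gives t = 1. *)
Definition no_instance (G : graph) : unweighted_nws_instance :=
  @UnweightedNWS G [:: set0] 1 1%:Z%:~R%R.

Definition deletion_instance (G : graph) : unweighted_nws_instance :=
  @UnweightedNWS G [seq [set~ v] | v <- enum (vertex G)]
    (Defs.order G)%:Z (Defs.order G)%:Z%:~R%R.

Definition nws_of_graph (G : graph) : unweighted_nws_instance :=
  if Defs.order G < 3 then no_instance G else deletion_instance G.

Lemma nws_graph_of_graph G : nws_graph (nws_of_graph G) = G.
Proof. by rewrite /nws_of_graph; case: ifP. Qed.

Lemma budget_of_graph G : (0 < budget (nws_of_graph G))%R.
Proof.
by rewrite /nws_of_graph; case: ltnP => //= order_gt2; rewrite ltr0z; lia.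
Qed.

Lemma components_set0 (T : finType) :
  hypergraph_components [:: set0 : {set T}] = #|T|.
Proof.
rewrite /hypergraph_components; set e := fun x y => _.
apply: eq_card => x; rewrite !inE andbT; apply/eqP.
have /connectP[p + ->] := connect_root e x.
by case: p => //= y p; rewrite /e /= !inE.
Qed.

Lemma components_deletions (T : finType) :
  2 < #|T| -> hypergraph_components [seq [set~ v] | v <- enum T] = 1.
Proof.
move=> card_T; rewrite /hypergraph_components; set e := fun x y => _.
have e_total x y : e x y.
  have [z z_x z_y] := exists_third x y card_T.
  apply/hasP; exists [set~ z]; first by apply: map_f; rewrite mem_enum.
  by rewrite !inE ![_ == z]eq_sym z_x.
have /card_gt0P[x _] : 0 < #|T| by apply: leq_trans card_T.
have e_sym : connect_sym e by move=> y z; rewrite !connect1.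
rewrite -(n_comp_connect e_sym x); apply: eq_n_comp_r => y.
by rewrite !inE connect1.
Qed.

Lemma nws_t_of_graph G : nws_t (nws_of_graph G) = 1%R.
Proof.
rewrite /nws_t /nws_of_graph; case: ltnP => order_G /=.
  by rewrite components_set0 card_ord; lia.
by rewrite components_deletions ?card_ord //; lia.
Qed.

Lemma no_instanceP G : ~ @yes unweighted_connectivity_nws (no_instance G).
Proof. by case=> E' [_ _ _ /(_ set0)]; rewrite mem_head => /(_ isT)[/eqP]. Qed.

Lemma hamiltonian_cycle_order G (s : seq (vertex G)) :
  is_hamiltonian_cycle s -> 2 < Defs.order G.
Proof.
case=> size_s /andP[_ /card_uniqP card_s] _.
by apply: leq_trans size_s _; rewrite -card_s -[leqRHS]card_ord max_card.
Qed.

Lemma deletion_instanceP G : 2 < Defs.order G ->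
  (exists s : seq (vertex G), is_hamiltonian_cycle s) <->
  @yes unweighted_connectivity_nws (deletion_instance G).
Proof.
move=> order_G.
split=> [[s [size_s cycle_s mem_s]]|[E' [sub_E le_order _ conn]]].
  have le_order : #|cycle_edges s| <= Defs.order G.
    by rewrite -[leqRHS]card_ord; apply: leq_imset_card.
  exists (cycle_edges s); split=> //=; first exact: cycle_edges_sub.
    by rewrite sumr_const -pmulrn ler_nat.
  by move=> _ /mapP[v _ ->]; apply: cycle_edges_deletion cycle_s _ _.
have [|e /(subsetP sub_E)|v||s [size_s cycle_s mem_s]] :=
  @cycle_of_deletions (vertex G) E'.
- by rewrite card_ord.
- exact: card_edge.
- by apply: conn; apply: map_f; rewrite mem_enum.
- by rewrite card_ord.
exists s; split=> //; case/andP: cycle_s => cycle_s uniq_s.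
apply/andP; split=> //; apply: sub_cycle cycle_s => x y; exact: (subsetP sub_E).
Qed.

Lemma nws_of_graphP G :
  (exists s : seq (vertex G), is_hamiltonian_cycle s) <->
  @yes unweighted_connectivity_nws (nws_of_graph G).
Proof.
rewrite /nws_of_graph; case: ltnP => order_G; last exact: deletion_instanceP.
split=> [[s /hamiltonian_cycle_order]|/no_instanceP//].
by rewrite ltnNge -ltnS order_G.
Qed.

Definition no_instance_word (x : bits) (n : nat) : bits :=
  enc_seq [:: x; enc_seq [:: mkseq (fun _ => false) n]; [:: false; true];
              enc_seq [:: [:: false; true]; [:: false; true]]].

Definition deletion_instance_word (x : bits) (n : nat) : bits :=
  enc_seq [:: x; enc_seq (mkseq (fun i => mkseq (fun j => ~~ (j == i)) n) n);
              false :: enc_nat n;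
              enc_seq [:: false :: enc_nat n; [:: false; true]]].

Definition reduction_word (x : bits) : bits :=
  let n := size (dec_seq x) in
  if n < 3 then no_instance_word x n else deletion_instance_word x n.

Lemma FP_reduction_word : FP reduction_word.
Proof.
have fp_no : FP2 no_instance_word by rewrite /no_instance_word; fp.
have fp_deletion : FP2 deletion_instance_word.
  by rewrite /deletion_instance_word; fp.
by rewrite /reduction_word; fp.
Qed.

Lemma enc_no_instance G :
  enc_unweighted_nws (no_instance G) =
  no_instance_word (enc_graph G) (Defs.order G).
Proof.
rewrite /enc_unweighted_nws /= /enc_rat numq_int denq_int.
congr (enc_seq [:: _; enc_seq [:: _]; _; enc_seq _]).
by rewrite mkseq_ord; apply: eq_map => i; rewrite inE.
Qed.

Lemma enc_deletion_instance G :
  enc_unweighted_nws (deletion_instance G) =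
  deletion_instance_word (enc_graph G) (Defs.order G).
Proof.
rewrite /enc_unweighted_nws /= /enc_rat numq_int denq_int.
congr (enc_seq [:: _; enc_seq _; _; enc_seq _]).
rewrite mkseq_ord -map_comp; apply: eq_map => i /=.
by rewrite mkseq_ord; apply: eq_map => j; rewrite !inE.
Qed.

Lemma enc_nws_of_graph G :
  enc_unweighted_nws (nws_of_graph G) = reduction_word (enc_graph G).
Proof.
rewrite /reduction_word enc_seqK size_rows /nws_of_graph.
by case: ifP => _; [apply: enc_no_instance | apply: enc_deletion_instance].
Qed.

Lemma NP_hard_restrictW (P : problem) (D D' : instance P -> Prop) :
  (forall I, D I -> D' I) -> NP_hard (restrict D) -> NP_hard (restrict D').
Proof.
move=> sub_D hard_D L /hard_D[f [poly_f reduce_f]]; exists f; split=> // x.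
by have [[valid_fx /sub_D D_fx] yes_fx] := reduce_f x.
Qed.

Lemma NP_hard_reduction (P Q : problem) (f : instance P -> instance Q)
    (g : bits -> bits) :
  polytime g -> (forall I, encode (f I) = g (encode I)) ->
  (forall I, valid I -> valid (f I) /\ (yes I <-> yes (f I))) ->
  NP_hard P -> NP_hard Q.
Proof.
move=> poly_g encode_f reduce_f hard_P L /hard_P[h [poly_h reduce_h]].
exists (f \o h); split=> [|x].
  by apply: eq_polytime (polytime_comp poly_h poly_g) => x; rewrite /= encode_f.
have [valid_hx ->] := reduce_h x; exact: reduce_f valid_hx.
Qed.

Theorem theorem21 (Pi : graph_class) :
  NP_hard (restrict (P := hamiltonian_cycle) (fun G : graph => Pi G)) ->
  NP_complete (restrict (P := unweighted_connectivity_nws)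
    (fun I : unweighted_nws_instance => Pi (nws_graph I))) /\
  NP_complete (restrict (P := unweighted_connectivity_nws)
    (fun I : unweighted_nws_instance =>
       Pi (nws_graph I) /\ nws_t I = 1%R)).
Proof.
move=> hard_Pi.
have hard_t1 : NP_hard (restrict (P := unweighted_connectivity_nws)
    (fun I => Pi (nws_graph I) /\ nws_t I = 1%R)).
  apply: (NP_hard_reduction (P := restrict (P := hamiltonian_cycle) Pi)
    (Q := restrict (P := unweighted_connectivity_nws) _) (f := nws_of_graph)
    (polytime_FP FP_reduction_word) enc_nws_of_graph) hard_Pi => G [_ Pi_G].
  split; last exact: nws_of_graphP.
  split; first exact: budget_of_graph.
  by rewrite nws_graph_of_graph nws_t_of_graph.
split; split; try exact: in_NP_restrict nws_in_NP; last exact: hard_t1.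
by apply: NP_hard_restrictW hard_t1 => I [].
Qed.
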